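(* Let $n\ge1$ and let $g\in L^2(\mathbb{H}^n)$ be nonzero. Then $V_g(L^2(\mathbb{H}^n))=\{V_gf: f\in L^2(\mathbb{H}^n)\}$, with the inner product of $L^2(\mathbb{H}^n\times\mathbb{H}^n)$, is a reproducing kernel Hilbert space with reproducing kernel $$K_g\bigl((Q',P'),(Q,P)\bigr)=\frac{1}{\|g\|_2^2}V_g\bigl(\check{\pi}^{\mathrm{pr}}(Q,P)g\bigr)(Q',P')=\frac{1}{\|g\|_2^2}V_g\left(\mathcal{F}^{-1}\bigl(M_QT_P\mathcal{F}(g)\bigr)\right)(Q',P').$$ (That is, $V_gf(Q,P)=\langle V_gf,K_g((\cdot,\cdot),(Q,P))\rangle_{L^2(\mathbb{H}^n\times\mathbb{H}^n)}$ for all $f\in L^2(\mathbb{H}^n)$ and all $(Q,P)\in\mathbb{H}^n\times\mathbb{H}^n$.) Moreover, $\left|K_g\bigl((Q',P'),(Q,P)\bigr)\right|\le 1$ for all $(Q',P'),(Q,P)\in\mathbb{H}^n\times\mathbb{H}^n$.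
   Context: $\mathbb{H}^n=\mathbb{R}^n\times\mathbb{R}^n\times\mathbb{R}\cong\mathbb{R}^{2n+1}$ is the Heisenberg group with group law $(p,q,t)\cdot(p',q',t')=\left(p+p',q+q',t+t'+\tfrac12(pq'-qp')\right)$, where $pq$ is the Euclidean dot product on $\mathbb{R}^n$. Its Haar measure is Lebesgue measure on $\mathbb{R}^{2n+1}$, so $L^2(\mathbb{H}^n)=L^2(\mathbb{R}^{2n+1})$. Inner products of functions are linear in the first argument and conjugate-linear in the second. $\mathcal{F}$ is the Euclidean Fourier transform on $\mathbb{R}^{2n+1}$, $\mathcal{F}(h)(Q)=\int_{\mathbb{R}^{2n+1}}h(X)e^{-2\pi i\langle Q,X\rangle}\,dX$, extended to a unitary operator on $L^2(\mathbb{R}^{2n+1})$; here $\langle Q,X\rangle$ is the Euclidean inner product on $\mathbb{R}^{2n+1}$. For $P,Q,X\in\mathbb{H}^n$: $T_Ph(X)=h(X\cdot P)$ (Heisenberg product) and $M_Qh(X)=e^{2\pi i\langle Q,X\rangle}h(X)$. Put $\check{\pi}^{\mathrm{pr}}(Q,P)=\mathcal{F}^{-1}M_QT_P\mathcal{F}$, a unitary operator on $L^2(\mathbb{H}^n)$. The short-time Fourier transform of $f\in L^2(\mathbb{H}^n)$ with window $g\in L^2(\mathbb{H}^n)$ is $$V_gf(Q,P)=\langle f,\check{\pi}^{\mathrm{pr}}(Q,P)g\rangle=\langle\mathcal{F}(f),M_QT_P\mathcal{F}(g)\rangle=\int_{\mathbb{R}^{2n+1}}\mathcal{F}(f)(X)\,\overline{\mathcal{F}(g)(X\cdot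 P)}\,e^{-2\pi i\langle Q,X\rangle}\,dX,$$ defined pointwise for all $Q,P\in\mathbb{H}^n$; $V_gf\in L^2(\mathbb{H}^n\times\mathbb{H}^n)$. *)

(* Defs.v *)
From HB Require Import structures.
From mathcomp Require Import all_boot all_order all_algebra.
From mathcomp Require Import complex.
From mathcomp Require Import all_classical all_reals all_analysis.

Set Implicit Arguments.
Unset Strict Implicit.
Unset Printing Implicit Defensive.

Import Order.TTheory GRing.Theory Num.Theory.
Import numFieldNormedType.Exports.

Local Open Scope classical_set_scope.
Local Open Scope complex_scope.
Local Open Scope ring_scope.

Notation Rn R n := (n.-tuple (measurableTypeR R)).

(* [m1 \x m2] as a sigma-finite measure: the sigma-finite instance of
   [product_measure1] in the library is shadowed by the one declared for
   products of subprobabilities and is not found by unification *)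
Section sigma_prod.
Local Open Scope ereal_scope.
Context d1 d2 (T1 : measurableType d1) (T2 : measurableType d2) (R : realType).
Variable m1 : {sigma_finite_measure set T1 -> \bar R}.
Variable m2 : {sigma_finite_measure set T2 -> \bar R}.

Definition sigma_prod : set (T1 * T2) -> \bar R := m1 \x m2.

HB.instance Definition _ := Measure.copy sigma_prod (m1 \x m2).

Let sigma_prod_sigma_finite : sigma_finite setT sigma_prod.
Proof.
have /sigma_finiteP[F [TF ndF Foo]] := sigma_finiteT m1.
have /sigma_finiteP[G [TG ndG Goo]] := sigma_finiteT m2.
exists (fun n => F n `*` G n).
  rewrite -setXTT TF TG predeqE => -[x y]; split.
    move=> [/= [n _ Fnx] [k _ Gky]]; exists (maxn n k) => //; split.
    - by move: x Fnx; exact/subsetPset/ndF/leq_maxl.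
    - by move: y Gky; exact/subsetPset/ndG/leq_maxr.
  by move=> [n _ []/= ? ?]; split; exists n.
move=> k; have [? ?] := Foo k; have [? ?] := Goo k.
split; first exact: measurableX.
by rewrite /sigma_prod product_measure1E// lte_mul_pinfty// ge0_fin_numE.
Qed.

HB.instance Definition _ := Measure_isSigmaFinite.Build _ _ _ sigma_prod
  sigma_prod_sigma_finite.

End sigma_prod.

Section cons_measure.
Context (R : realType) (n : nat).
Variable mu : {sigma_finite_measure set (Rn R n) -> \bar R}.

Definition tuple_cons (z : measurableTypeR R * Rn R n) : Rn R n.+1 :=
  [the n.+1.-tuple (measurableTypeR R) of z.1 :: z.2].

Definition tuple_uncons (t : Rn R n.+1) : measurableTypeR R * Rn R n :=
  (thead t, [tuple of behead t]).

Lemma tuple_consK : cancel tuple_cons tuple_uncons.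
Proof.
by case=> x t; rewrite /tuple_uncons; congr (_, _); exact: val_inj.
Qed.

Lemma measurable_tuple_cons : measurable_fun setT tuple_cons.
Proof. by apply: measurable_cons. Qed.

Lemma measurable_tuple_uncons : measurable_fun setT tuple_uncons.
Proof.
by apply: measurable_fun_pair; [exact: measurable_tnth|exact: measurable_behead].
Qed.

(* the product measure on R * R^n, transported to R^(n+1) *)
Definition cons_measure : set (Rn R n.+1) -> \bar R :=
  pushforward (sigma_prod lebesgue_measure mu) tuple_cons.

Let cons_measure0 : cons_measure set0 = 0%E.
Proof. by rewrite /cons_measure /pushforward preimage_set0 measure0. Qed.

Let cons_measure_ge0 A : (0 <= cons_measure A)%E.
Proof. by rewrite /cons_measure /pushforward measure_ge0. Qed.

Let cons_measure_sigma_additive : semi_sigma_additive cons_measure.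
Proof.
have mc := measurable_tuple_cons.
move=> F mF tF mUF; rewrite /cons_measure /pushforward preimage_bigcup.
apply: measure_semi_sigma_additive.
- by move=> n'; rewrite -[X in measurable X]setTI; exact: mc.
- apply/trivIsetP => /= i j _ _ ij; rewrite -preimage_setI.
  by move/trivIsetP : tF => /(_ _ _ _ _ ij) ->//; rewrite preimage_set0.
- by rewrite -preimage_bigcup -[X in measurable X]setTI; exact: mc.
Qed.

HB.instance Definition _ := isMeasure.Build _ _ _ cons_measure
  cons_measure0 cons_measure_ge0 cons_measure_sigma_additive.

Let cons_measure_sigma_finite : sigma_finite setT cons_measure.
Proof.
have [F FT mF] := sigma_finiteT (sigma_prod lebesgue_measure mu).
exists (fun k => tuple_uncons @^-1` F k) => [|k].
  by rewrite -preimage_bigcup -FT preimage_setT.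
have [mFk Fkoo] := mF k; split.
  by rewrite -[X in measurable X]setTI; exact: measurable_tuple_uncons.
rewrite /cons_measure /pushforward -comp_preimage.
by rewrite (_ : _ \o _ = id) ?preimage_id//; exact/funext/tuple_consK.
Qed.

HB.instance Definition _ := Measure_isSigmaFinite.Build _ _ _ cons_measure
  cons_measure_sigma_finite.

End cons_measure.

Fixpoint lebesgueRn (R : realType) (n : nat) :
    {sigma_finite_measure set (Rn R n) -> \bar R} :=
  match n with
  | 0 => \d_[tuple]
  | m.+1 => cons_measure (lebesgueRn R m)
  end.

Local Notation Re := complex.Re.
Local Notation Im := complex.Im.

Section complex_functions.
Context d (T : measurableType d) (R : realType).
Variable mu : {measure set T -> \bar R}.
Implicit Types f h : T -> R[i].

(* the modulus as an element of R ([`|z|] lives in R[i]) *)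
Definition cabs (z : R[i]) : R := Normc.normc z.

Definition cmeasurable f : Prop :=
  measurable_fun [set: T] (fun x => Re (f x)) /\
  measurable_fun [set: T] (fun x => Im (f x)).

Definition cint f : R[i] :=
  (\int[mu]_x Re (f x)) +i* (\int[mu]_x Im (f x)).

Definition cLnorm (p : \bar R) f : \bar R :=
  Lnorm mu p (fun x => (cabs (f x))%:E).

Definition cLp (p : \bar R) f : Prop :=
  cmeasurable f /\ (cLnorm p f < +oo)%E.

Definition L2norm f : R := fine (cLnorm 2%:E f).

Definition L2dot f h : R[i] := cint (fun x => f x * (h x)^*).

End complex_functions.

Definition cexpi (R : realType) (a : R) : R[i] := cos a +i* sin a.

Section rkhs.
Context (X : Type) (R : realType).
Variable S : set (X -> R[i]).
Variable ip : (X -> R[i]) -> (X -> R[i]) -> R[i].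
Implicit Types f h : X -> R[i].

Definition ipnorm f : R := Num.sqrt (Re (ip f f)).

(* [S] is a linear space of functions (equality of vectors is pointwise
   equality) on which [ip] is a complete inner product *)
Record hilbert_function_space : Prop := {
  hfs_zero : S (fun=> 0) ;
  hfs_lin : forall (a : R[i]) f h, S f -> S h -> S (fun x => a * f x + h x) ;
  hfs_ip_lin : forall (a : R[i]) f h k, S f -> S h -> S k ->
    ip (fun x => a * f x + h x) k = a * ip f k + ip h k ;
  hfs_ip_herm : forall f h, S f -> S h -> ip h f = (ip f h)^* ;
  hfs_ip_ge0 : forall f, S f -> 0 <= ip f f ;
  hfs_ip_def : forall f, S f -> ip f f = 0 -> forall x, f x = 0 ;
  hfs_complete : forall u : nat -> X -> R[i], (forall k, S (u k)) ->
    (forall e : R, 0 < e -> exists N, forall j k, (N <= j)%N -> (N <= k)%N ->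
      ipnorm (fun x => u j x - u k x) < e) ->
    exists2 f, S f & forall e : R, 0 < e -> exists N, forall k, (N <= k)%N ->
      ipnorm (fun x => u k x - f x) < e
}.

Definition bounded_evaluations : Prop :=
  forall x, exists C : R, forall f, S f -> cabs (f x) <= C * ipnorm f.

Definition is_rkhs : Prop := hilbert_function_space /\ bounded_evaluations.

Definition is_reproducing_kernel (K : X -> X -> R[i]) : Prop :=
  forall x, S (K ^~ x) /\ (forall f, S f -> f x = ip f (K ^~ x)).

End rkhs.

(* (p, q, t) is stored as ((p, q), t) *)
Notation heis R n := (Rn R n * Rn R n * measurableTypeR R)%type.

Section heisenberg.
Context (R : realType) (n : nat).
Local Notation H := (heis R n).

Definition vdot (p q : Rn R n) : R :=
  \sum_(i < n) (tnth p i : R) * (tnth q i : R).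

Definition vadd (p q : Rn R n) : Rn R n :=
  [tuple ((tnth p i : R) + (tnth q i : R)) | i < n].

Definition hmul (X Y : H) : H :=
  let: (p, q, t) := X in let: (p', q', t') := Y in
  (vadd p p', vadd q q',
   (t : R) + (t' : R) + 2^-1 * (vdot p q' - vdot q p')).

Definition hdot (X Y : H) : R :=
  let: (p, q, t) := X in let: (p', q', t') := Y in
  vdot p p' + vdot q q' + (t : R) * (t' : R).

(* Lebesgue measure on H^n = R^(2n+1) *)
Definition haar : {sigma_finite_measure set H -> \bar R} :=
  sigma_prod (sigma_prod (lebesgueRn R n) (lebesgueRn R n)) lebesgue_measure.

Definition haar2 : {sigma_finite_measure set (H * H)%type -> \bar R} :=
  sigma_prod haar haar.

Definition translation (P : H) (h : H -> R[i]) : H -> R[i] :=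
  fun X => h (hmul X P).

Definition modulation (Q : H) (h : H -> R[i]) : H -> R[i] :=
  fun X => cexpi (2 * pi * hdot Q X) * h X.

Definition fourier_integral (h : H -> R[i]) : H -> R[i] :=
  fun Q => cint haar (fun X => h X * cexpi (- (2 * pi * hdot Q X))).

(* Elements of L^2 are represented by functions, so identities between
   elements of L^2 hold almost everywhere. *)
Record unitary_fourier_extension (U : (H -> R[i]) -> (H -> R[i])) : Prop := {
  ufe_L2 : forall f, cLp haar 2%:E f -> cLp haar 2%:E (U f) ;
  ufe_lin : forall (a : R[i]) f h, cLp haar 2%:E f -> cLp haar 2%:E h ->
    {ae haar, forall X, U (fun Y => a * f Y + h Y) X = a * U f X + U h X} ;
  ufe_dot : forall f h, cLp haar 2%:E f -> cLp haar 2%:E h ->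
    L2dot haar (U f) (U h) = L2dot haar f h ;
  ufe_surj : forall h, cLp haar 2%:E h ->
    exists2 f, cLp haar 2%:E f & {ae haar, forall X, U f X = h X} ;
  ufe_integral : forall f, cLp haar 1%:E f -> cLp haar 2%:E f ->
    {ae haar, forall X, U f X = fourier_integral f X}
}.

(* By Plancherel's theorem a unitary extension exists and is unique up to
   almost everywhere equality; [xget] picks one. *)
Definition fourier : (H -> R[i]) -> (H -> R[i]) :=
  xget (@idfun (H -> R[i])) [set U | unitary_fourier_extension U].

(* On L^2: a representative of the preimage of [h] under [fourier]. *)
Definition inv_fourier (h : H -> R[i]) : H -> R[i] :=
  xget (fun=> 0) [set f | cLp haar 2%:E f /\
                          {ae haar, forall X, fourier f X = h X}].

Definition pi_pr (Q P : H) (h : H -> R[i]) : H -> R[i] :=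
  inv_fourier (modulation Q (translation P (fourier h))).

Definition stft (g f : H -> R[i]) : (H * H)%type -> R[i] :=
  fun z => L2dot haar f (pi_pr z.1 z.2 g).

Definition stft_range (g : H -> R[i]) : set ((H * H)%type -> R[i]) :=
  [set stft g f | f in cLp haar 2%:E].

Definition stft_kernel (g : H -> R[i]) (z' z : (H * H)%type) : R[i] :=
  ((L2norm haar g ^+ 2)^-1)%:C * stft g (pi_pr z.1 z.2 g) z'.

End heisenberg.

(* Main.v *)
(** [stft g f (Q, P)] is the Fourier transform at [Q] of the integrable function
    [X |-> fourier f X * (fourier g (hmul X P))^*]. Plancherel's identity in [Q], for
    functions that are both integrable and square integrable, and the invariance of
    Lebesgue measure under left and right translations therefore give
    [||stft g f||^2 = ||f||^2 ||g||^2]. Polarization, the Cauchy-Schwarz inequality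
    and the completeness of [L^2] do the rest.

    Plancherel's identity passes to product measures by partial transforms, so it
    only needs an argument on the line. There the means of [|ft h|^2] against
    [exp (- 2 pi s |q|)] are quadratic forms in [h] with the Poisson kernel;
    letting [s] tend to [0], Schur's test yields [||ft h|| <= ||h||], with equality
    when [h] is the indicator of an interval. As [||h||^2 - ||ft h||^2] is thus a
    nonnegative quadratic form, its zeros are a closed subspace, which then
    contains every integrable and square integrable function. *)
Require Import Defs.
From mathcomp Require Import all_boot all_order all_algebra.
From mathcomp Require Import complex finmap ring lra.
From mathcomp Require Import all_classical all_reals all_analysis.
From mathcomp Require Import measurable_realfun.

Set Implicit Arguments.
Unset Strict Implicit.
Unset Printing Implicit Defensive.

Import Order.TTheory GRing.Theory Num.Theory.
Import numFieldNormedType.Exports.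

Local Open Scope classical_set_scope.
Local Open Scope complex_scope.
Local Open Scope ring_scope.

Local Notation Re := complex.Re.
Local Notation Im := complex.Im.

(** * Complex-valued integrable and square integrable functions *)

Section complex_arithmetic.
Context {R : realType}.
Implicit Types (z w : R[i]) (a : R).

(** On the line the obstacle is that Fubini does not apply to the integral of |ft h(q)|^2 over q:
    opened as a triple integral, it does not converge absolutely. The weight exp(- 2 pi s |q|)
    repairs this, and both its transform and the primitive of that transform are explicit. Schur's
    test alone gives only an inequality; equality for a general h would require convergence of
    Poisson integrals in L^2. For an interval they are differences of two arctangents, with
    elementary limits, and the positivity of the defect propagates equality from there.

    Functions both integrable and square integrable are the right class because there the transform
    is an actual integral with a value at every point. This fits [stft], which is defined pointwise:
    at fixed P its integrand is a product of two square integrable functions, hence integrable for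
    every P, and by Tonelli it is square integrable for almost every P. The operator [fourier] is
    determined only almost everywhere and enters through isometry and surjectivity; the transform
    computed with its phase is the one in Q. *)

Definition nsq z : R := Re z ^+ 2 + Im z ^+ 2.

Lemma cReD z w : Re (z + w) = Re z + Re w. Proof. by case: z; case: w. Qed.
Lemma cImD z w : Im (z + w) = Im z + Im w. Proof. by case: z; case: w. Qed.
Lemma cReN z : Re (- z) = - Re z. Proof. by case: z. Qed.
Lemma cImN z : Im (- z) = - Im z. Proof. by case: z. Qed.
Lemma cReM z w : Re (z * w) = Re z * Re w - Im z * Im w.
Proof. by case: z; case: w. Qed.
Lemma cImM z w : Im (z * w) = Re z * Im w + Im z * Re w.
Proof. by case: z => a b; case: w => c e /=; rewrite addrC. Qed.
Lemma cReC z : Re z^* = Re z. Proof. by case: z. Qed.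
Lemma cImC z : Im z^* = - Im z. Proof. by case: z. Qed.

Lemma Re_real a : Re a%:C = a. Proof. by []. Qed.
Lemma Im_real a : Im a%:C = 0. Proof. by []. Qed.
Lemma Re1 : Re (1 : R[i]) = 1. Proof. by []. Qed.
Lemma Im1 : Im (1 : R[i]) = 0. Proof. by []. Qed.

Definition reimE := (cReD, cImD, cReN, cImN, cReM, cImM, cReC, cImC).

Lemma complexP z w : Re z = Re w -> Im z = Im w -> z = w.
Proof. by case: z => a b; case: w => c e /= -> ->. Qed.

Lemma nsq_ge0 z : 0 <= nsq z.
Proof. by rewrite addr_ge0 ?sqr_ge0. Qed.

Lemma nsqM z w : nsq (z * w) = nsq z * nsq w.
Proof. by rewrite /nsq !reimE; ring. Qed.

Lemma nsqC z : nsq z^* = nsq z.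
Proof. by rewrite /nsq !reimE; ring. Qed.

Lemma nsq_real a : nsq a%:C = a ^+ 2.
Proof. by rewrite /nsq /= expr0n addr0. Qed.

Lemma nsq_eq0 z : nsq z = 0 -> z = 0.
Proof.
move=> /eqP; rewrite paddr_eq0 ?sqr_ge0// !sqrf_eq0 => /andP[/eqP a /eqP b].
exact: complexP.
Qed.

Lemma nsq_cexpi a : nsq (cexpi a) = 1.
Proof. exact: cos2Dsin2. Qed.

Lemma conj_cexpi a : (cexpi a)^* = cexpi (- a).
Proof. by rewrite /cexpi cosN sinN. Qed.

Lemma cexpiD (a b : R) : cexpi (a + b) = cexpi a * cexpi b.
Proof. by apply: complexP; rewrite !reimE /= ?cosD ?sinD//; ring. Qed.

Lemma nsqD_le z w : nsq (z + w) <= 2 * nsq z + 2 * nsq w.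
Proof.
rewrite /nsq !reimE.
have := sqr_ge0 (Re z - Re w); have := sqr_ge0 (Im z - Im w); nra.
Qed.

Lemma cabsE z : cabs z = Num.sqrt (nsq z).
Proof. by case: z. Qed.

Lemma sqr_cabs z : cabs z ^+ 2 = nsq z.
Proof. by rewrite cabsE sqr_sqrtr// nsq_ge0. Qed.

Lemma cabs_ge0 z : 0 <= cabs z.
Proof. by rewrite cabsE sqrtr_ge0. Qed.

Lemma normr_Re_le z : `|Re z| <= cabs z.
Proof.
by rewrite cabsE -sqrtr_sqr ler_sqrt ?nsq_ge0// /nsq lerDl sqr_ge0.
Qed.

Lemma normr_Im_le z : `|Im z| <= cabs z.
Proof.
by rewrite cabsE -sqrtr_sqr ler_sqrt ?nsq_ge0// /nsq lerDr sqr_ge0.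
Qed.

Lemma cabs_le z : cabs z <= `|Re z| + `|Im z|.
Proof.
rewrite cabsE -[leRHS]ger0_norm ?addr_ge0// -sqrtr_sqr ler_sqrt ?sqr_ge0//.
rewrite /nsq -(real_normK (num_real (Re z))) -(real_normK (num_real (Im z))).
have := normr_ge0 (Re z); have := normr_ge0 (Im z); nra.
Qed.

Lemma cabsM z w : cabs (z * w) = cabs z * cabs w.
Proof. by rewrite !cabsE nsqM sqrtrM// nsq_ge0. Qed.

End complex_arithmetic.

Section complex_measurability.
Context d (T : measurableType d) (R : realType).
Implicit Types f h : T -> R[i].

Lemma cmeasurable_cst (c : R[i]) : cmeasurable (fun _ : T => c).
Proof. by split; exact: measurable_cst. Qed.

Lemma cmeasurableD f h : cmeasurable f -> cmeasurable h ->
  cmeasurable (fun x => f x + h x).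
Proof.
move=> [f1 f2] [h1 h2]; split.
  by under eq_fun do rewrite cReD; exact: measurable_funD.
by under eq_fun do rewrite cImD; exact: measurable_funD.
Qed.

Lemma cmeasurableM f h : cmeasurable f -> cmeasurable h ->
  cmeasurable (fun x => f x * h x).
Proof.
move=> [f1 f2] [h1 h2]; split.
  under eq_fun do rewrite cReM.
  by apply: measurable_funB; exact: measurable_funM.
under eq_fun do rewrite cImM.
by apply: measurable_funD; exact: measurable_funM.
Qed.

Lemma cmeasurableN f : cmeasurable f -> cmeasurable (fun x => - f x).
Proof.
move=> [f1 f2]; split.
  by under eq_fun do rewrite cReN; exact: measurable_funN.
by under eq_fun do rewrite cImN; exact: measurable_funN.
Qed.

Lemma cmeasurable_conj f : cmeasurable f -> cmeasurable (fun x => (f x)^*).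
Proof.
move=> [f1 f2]; split; first by under eq_fun do rewrite cReC.
by under eq_fun do rewrite cImC; exact: measurable_funN.
Qed.

Lemma cmeasurable_cexpi (a : T -> R) : measurable_fun setT a ->
  cmeasurable (fun x => cexpi (a x)).
Proof.
move=> ma; split => /=; apply: measurableT_comp => //.
  by apply: continuous_measurable_fun; exact: continuous_cos.
by apply: continuous_measurable_fun; exact: continuous_sin.
Qed.

Lemma measurable_nsq f : cmeasurable f -> measurable_fun setT (nsq \o f).
Proof.
by move=> [f1 f2]; apply: measurable_funD; exact: measurable_funX.
Qed.

Lemma measurable_EFin_nsq f : cmeasurable f ->
  measurable_fun setT (fun x => (nsq (f x))%:E).
Proof. by move=> mf; apply/measurable_EFinP; exact: measurable_nsq. Qed.

Lemma measurable_cabs f : cmeasurable f -> measurable_fun setT (@cabs R \o f).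
Proof.
move=> mf; rewrite (_ : _ \o _ = (@Num.sqrt R) \o (nsq \o f)); last first.
  by apply/funext => x /=; rewrite cabsE.
apply: measurableT_comp; last exact: measurable_nsq.
by apply: continuous_measurable_fun; exact: sqrt_continuous.
Qed.

End complex_measurability.

Lemma cmeasurable_comp d1 d2 (T1 : measurableType d1) (T2 : measurableType d2)
    (R : realType) (f : T2 -> R[i]) (u : T1 -> T2) :
  cmeasurable f -> measurable_fun setT u -> cmeasurable (f \o u).
Proof.
move=> [f1 f2] mu; split.
  exact: (measurableT_comp f1 mu).
exact: (measurableT_comp f2 mu).
Qed.

Section complex_integral.
Context d (T : measurableType d) (R : realType).
Variable mu : {measure set T -> \bar R}.
Implicit Types f h : T -> R[i].

Definition cintegrable f : Prop :=
  mu.-integrable setT (EFin \o (fun x => Re (f x))) /\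
  mu.-integrable setT (EFin \o (fun x => Im (f x))).

Lemma cintegrable_measurable f : cintegrable f -> cmeasurable f.
Proof.
by move=> [f1 f2]; split; apply/measurable_EFinP; exact: measurable_int mu _ _ _.
Qed.

Lemma cintegrable_cabsP f : cintegrable f <->
  cmeasurable f /\ (\int[mu]_x (cabs (f x))%:E < +oo)%E.
Proof.
split=> [if_|[mf fi]].
  have mf := cintegrable_measurable if_; split => //; case: if_ => f1 f2.
  have i1 := integrable_abse f1; have i2 := integrable_abse f2.
  apply: le_lt_trans (integrable_lty measurableT (integrableD measurableT i1 i2)).
  apply: ge0_le_integral => //.
  - by move=> x _; rewrite lee_fin cabs_ge0.
  - by apply/measurable_EFinP; exact: measurable_cabs.
  - apply: emeasurable_funD; exact: measurable_int mu _ _ _.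
  - by move=> x _ /=; rewrite -EFinD lee_fin cabs_le.
have ic : mu.-integrable setT (EFin \o (@cabs R \o f)).
  apply/integrableP; split; first by apply/measurable_EFinP; exact: measurable_cabs.
  by under eq_integral do rewrite /= ger0_norm ?cabs_ge0//.
split; apply: le_integrable ic => //.
- by apply/measurable_EFinP; case: mf.
- by move=> x _ /=; rewrite lee_fin (ger0_norm (cabs_ge0 _)) normr_Re_le.
- by apply/measurable_EFinP; case: mf.
- by move=> x _ /=; rewrite lee_fin (ger0_norm (cabs_ge0 _)) normr_Im_le.
Qed.

Lemma le_cintegrable f (g : T -> R) : cmeasurable f ->
  mu.-integrable setT (EFin \o g) -> (forall x, cabs (f x) <= g x) ->
  cintegrable f.
Proof.
move=> mf ig fg; apply/cintegrable_cabsP; split => //.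
apply: le_lt_trans (integrable_lty measurableT ig).
apply: ge0_le_integral => //.
- by move=> x _; rewrite lee_fin cabs_ge0.
- by apply/measurable_EFinP; exact: measurable_cabs.
- exact: measurable_int mu _ _ _.
- by move=> x _ /=; rewrite lee_fin fg.
Qed.

Lemma cintegrable_cabs f : cintegrable f ->
  mu.-integrable setT (EFin \o (@cabs R \o f)).
Proof.
move=> /cintegrable_cabsP [mf fi]; apply/integrableP; split.
  by apply/measurable_EFinP; exact: measurable_cabs.
by under eq_integral do rewrite /= ger0_norm ?cabs_ge0//.
Qed.

Lemma cintegrableD f h : cintegrable f -> cintegrable h ->
  cintegrable (fun x => f x + h x).
Proof.
move=> [f1 f2] [h1 h2]; split.
  by apply: eq_integrable (integrableD measurableT f1 h1) => // x _ /=; rewrite cReD.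
by apply: eq_integrable (integrableD measurableT f2 h2) => // x _ /=; rewrite cImD.
Qed.

Lemma cintegrable_bounded f e (C : R) : cintegrable f -> cmeasurable e ->
  (forall x, cabs (e x) <= C) -> cintegrable (fun x => f x * e x).
Proof.
move=> if_ me eC; have mf := cintegrable_measurable if_.
apply: (@le_cintegrable _ (fun x => C * cabs (f x))).
- exact: cmeasurableM.
- exact: (integrableZl measurableT C (cintegrable_cabs if_)).
- by move=> x; rewrite cabsM mulrC ler_wpM2r ?cabs_ge0.
Qed.

Lemma cintegrableZ (a : R[i]) f : cintegrable f -> cintegrable (fun x => a * f x).
Proof.
move=> /cintegrable_bounded if_; under eq_fun do rewrite mulrC.
by apply: (if_ (fun=> a) (cabs a)) => //; exact: cmeasurable_cst.
Qed.

Lemma cintegrable_conj f : cintegrable f -> cintegrable (fun x => (f x)^*).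
Proof.
move=> if_; apply: le_cintegrable (cintegrable_cabs if_) _.
  exact/cmeasurable_conj/cintegrable_measurable.
by move=> x /=; rewrite !cabsE nsqC.
Qed.

Lemma cintD f h : cintegrable f -> cintegrable h ->
  cint mu (fun x => f x + h x) = cint mu f + cint mu h.
Proof.
move=> [f1 f2] [h1 h2]; apply: complexP; rewrite !reimE /cint /=.
  by rewrite -RintegralD//; apply: eq_Rintegral => x _; rewrite cReD.
by rewrite -RintegralD//; apply: eq_Rintegral => x _; rewrite cImD.
Qed.

Lemma cintZ (a : R[i]) f : cintegrable f ->
  cint mu (fun x => a * f x) = a * cint mu f.
Proof.
move=> [f1 f2]; apply: complexP; rewrite !reimE /cint /=.
  rewrite -!RintegralZl// -RintegralB//; last 2 first.
  - exact: (integrableZl measurableT (Re a) f1).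
  - exact: (integrableZl measurableT (Im a) f2).
  by apply: eq_Rintegral => x _; rewrite cReM.
rewrite -!RintegralZl// -RintegralD//; last 2 first.
- exact: (integrableZl measurableT (Re a) f2).
- exact: (integrableZl measurableT (Im a) f1).
by apply: eq_Rintegral => x _; rewrite cImM.
Qed.

Lemma cint_conj f : cintegrable f -> cint mu (fun x => (f x)^*) = (cint mu f)^*.
Proof.
move=> [f1 f2]; apply: complexP; rewrite !reimE /cint /=.
  by apply: eq_Rintegral => x _; rewrite cReC.
rewrite -mulN1r -RintegralZl//.
by apply: eq_Rintegral => x _; rewrite cImC mulN1r.
Qed.

Lemma eq_cint f h : f =1 h -> cint mu f = cint mu h.
Proof. by move=> /funext ->. Qed.

Lemma ae_eq_cint f h : cmeasurable f -> cmeasurable h ->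
  {ae mu, forall x, f x = h x} -> cint mu f = cint mu h.
Proof.
move=> [f1 f2] [h1 h2] fh; apply: complexP; rewrite /cint /= /Rintegral; congr fine;
  apply: ae_eq_integral => //; try exact/measurable_EFinP.
  by apply: filterS fh => x ->.
by apply: filterS fh => x ->.
Qed.

End complex_integral.

Section square_integrable.
Context d (T : measurableType d) (R : realType).
Variable mu : {measure set T -> \bar R}.
Implicit Types f h k : T -> R[i].

(** The squared norm comes in two versions: [enorm2], in the extended reals, lets Tonelli and
    monotone limits apply before finiteness is known; [norm2], its [fine] part, serves the algebra.
    Neither contains the root hidden in [Lnorm], and [nsq] is a polynomial in the two parts, within
    reach of [ring] and [nra]. *)
Definition enorm2 f : \bar R := (\int[mu]_x (nsq (f x))%:E)%E.

Definition L2 f : Prop := cmeasurable f /\ (enorm2 f < +oo)%E.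

Definition norm2 f : R := \int[mu]_x nsq (f x).

Lemma enorm2_ge0 f : (0 <= enorm2 f)%E.
Proof. by apply: integral_ge0 => x _; rewrite lee_fin nsq_ge0. Qed.

Lemma norm2_ge0 f : 0 <= norm2 f.
Proof. exact/fine_ge0/enorm2_ge0. Qed.

Lemma enorm2E f : L2 f -> enorm2 f = (norm2 f)%:E.
Proof.
by move=> [_ fi]; rewrite /norm2 /Rintegral fineK// ge0_fin_numE ?enorm2_ge0.
Qed.

Lemma poweR_cLnorm f : (cLnorm mu 2%:E f `^ 2 = enorm2 f)%E.
Proof.
rewrite /cLnorm poweR_Lnorm//; apply: eq_integral => x _.
by rewrite /= ger0_norm ?cabs_ge0// powR_mulrn ?cabs_ge0// sqr_cabs.
Qed.

Lemma cLp2P f : cLp mu 2%:E f <-> L2 f.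
Proof.
split=> -[mf fi]; split => //; first by rewrite -poweR_cLnorm poweR_lty.
by rewrite -poweR_cLnorm in fi; exact: lty_poweRy fi.
Qed.

Lemma sqr_L2norm f : L2norm mu f ^+ 2 = norm2 f.
Proof.
rewrite /norm2 /Rintegral -/(enorm2 f) -poweR_cLnorm /L2norm.
have : (0 <= cLnorm mu 2%:E f)%E by exact: Lnorm_ge0.
case: (cLnorm mu 2%:E f) => [r r0|_|//]; first by rewrite /= powR_mulrn.
(* An infinite norm is sent to 0 by [fine] on both sides. *)
by rewrite poweRyr// /= expr0n.
Qed.

Lemma integrable_nsq f : L2 f -> mu.-integrable setT (EFin \o (nsq \o f)).
Proof.
move=> [mf fi]; apply/integrableP; split.
  by apply/measurable_EFinP; exact: measurable_nsq.
by under eq_integral do rewrite /= ger0_norm ?nsq_ge0//.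
Qed.

Lemma le_L2 f (g : T -> R) : cmeasurable f -> mu.-integrable setT (EFin \o g) ->
  (forall x, nsq (f x) <= g x) -> L2 f.
Proof.
move=> mf ig fg; split => //.
apply: le_lt_trans (integrable_lty measurableT ig).
apply: ge0_le_integral => //.
- by move=> x _; rewrite lee_fin nsq_ge0.
- exact: measurable_EFin_nsq.
- exact: measurable_int mu _ _ _.
- by move=> x _ /=; rewrite lee_fin fg.
Qed.

Lemma L2_0 : L2 (fun=> 0).
Proof.
split; first exact: cmeasurable_cst.
by rewrite /enorm2 integral0_eq// => x _; rewrite /nsq /= expr0n /= addr0.
Qed.

Lemma L2D f h : L2 f -> L2 h -> L2 (fun x => f x + h x).
Proof.
move=> Lf Lh; apply: (@le_L2 _ (fun x => 2 * nsq (f x) + 2 * nsq (h x))).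
- by apply: cmeasurableD; [case: Lf|case: Lh].
- have := integrableD measurableT (integrableZl measurableT 2 (integrable_nsq Lf))
    (integrableZl measurableT 2 (integrable_nsq Lh)).
  exact.
- by move=> x; exact: nsqD_le.
Qed.

Lemma L2_bounded f e (C : R) : L2 f -> cmeasurable e ->
  (forall x, nsq (e x) <= C) -> L2 (fun x => e x * f x).
Proof.
move=> Lf me eC; apply: (@le_L2 _ (fun x => C * nsq (f x))).
- by apply: cmeasurableM => //; case: Lf.
- exact: (integrableZl measurableT C (integrable_nsq Lf)).
- by move=> x; rewrite nsqM ler_wpM2r ?nsq_ge0.
Qed.

Lemma L2Z (a : R[i]) f : L2 f -> L2 (fun x => a * f x).
Proof.
by move=> Lf; apply: (@L2_bounded f (fun=> a) (nsq a)).
Qed.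

Lemma L2B f h : L2 f -> L2 h -> L2 (fun x => f x - h x).
Proof.
move=> Lf /(L2Z (-1)) Lh; have := L2D Lf Lh.
by under eq_fun do rewrite mulN1r.
Qed.

(** The elementary bound [|f h| <= |f|^2 + |h|^2] dominates the product. *)
Lemma cintegrable_mul_conj f h : L2 f -> L2 h ->
  cintegrable mu (fun x => f x * (h x)^*).
Proof.
move=> Lf Lh; apply: (@le_cintegrable _ _ _ _ _ (fun x => nsq (f x) + nsq (h x))).
- by apply: cmeasurableM; [case: Lf|apply: cmeasurable_conj; case: Lh].
- exact: (integrableD measurableT (integrable_nsq Lf) (integrable_nsq Lh)).
- move=> x; rewrite cabsM !cabsE nsqC.
  have := sqr_sqrtr (nsq_ge0 (f x)); have := sqr_sqrtr (nsq_ge0 (h x)).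
  move: (Num.sqrt (nsq (f x))) (Num.sqrt (nsq (h x))) => a b.
  move=> <- <-; have := sqr_ge0 (a - b); have := sqr_ge0 (a + b); nra.
Qed.

Lemma L2dotDl f h k : L2 f -> L2 h -> L2 k ->
  L2dot mu (fun x => f x + h x) k = L2dot mu f k + L2dot mu h k.
Proof.
move=> Lf Lh Lk; rewrite /L2dot -cintD; [|exact: cintegrable_mul_conj..].
by apply: eq_cint => x; rewrite mulrDl.
Qed.

Lemma L2dotZl (a : R[i]) f h : L2 f -> L2 h ->
  L2dot mu (fun x => a * f x) h = a * L2dot mu f h.
Proof.
move=> Lf Lh; rewrite /L2dot -cintZ; last exact: cintegrable_mul_conj.
by apply: eq_cint => x; rewrite mulrA.
Qed.

Lemma L2dotC f h : L2 f -> L2 h -> L2dot mu h f = (L2dot mu f h)^*.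
Proof.
move=> Lf Lh; rewrite /L2dot -cint_conj; last exact: cintegrable_mul_conj.
by apply: eq_cint => x; rewrite rmorphM /= conjCK mulrC.
Qed.

Lemma L2dotlin (a : R[i]) f h k : L2 f -> L2 h -> L2 k ->
  L2dot mu (fun x => a * f x + h x) k = a * L2dot mu f k + L2dot mu h k.
Proof.
by move=> Lf Lh Lk; rewrite L2dotDl ?L2dotZl//; exact: L2Z.
Qed.

Lemma L2dotff f : L2dot mu f f = (norm2 f)%:C.
Proof.
apply: complexP => /=.
  by apply: eq_Rintegral => x _; rewrite !reimE /nsq; ring.
rewrite /Rintegral integral0_eq// => x _.
by rewrite !reimE; congr EFin; ring.
Qed.

Lemma Re_L2dotff f : Re (L2dot mu f f) = norm2 f.
Proof. by rewrite L2dotff. Qed.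

Lemma norm2D f h : L2 f -> L2 h ->
  norm2 (fun x => f x + h x) = norm2 f + norm2 h + 2 * Re (L2dot mu f h).
Proof.
move=> Lf Lh; have Lfh := L2D Lf Lh.
have -> : norm2 (fun x => f x + h x) =
    Re (L2dot mu (fun x => f x + h x) (fun x => f x + h x)) by rewrite Re_L2dotff.
rewrite (L2dotDl Lf Lh Lfh) (L2dotC Lfh Lf) (L2dotC Lfh Lh).
rewrite (L2dotDl Lf Lh Lf) (L2dotDl Lf Lh Lh) !reimE !Re_L2dotff.
rewrite (L2dotC Lf Lh) !reimE; ring.
Qed.

Lemma norm2Z (a : R[i]) f : L2 f -> norm2 (fun x => a * f x) = nsq a * norm2 f.
Proof.
move=> Lf; rewrite /norm2 -RintegralZl//; last exact: integrable_nsq.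
by apply: eq_Rintegral => x _; rewrite nsqM.
Qed.

(* <f, i h> = - i <f, h> *)
Lemma L2dot_polarization f h : L2 f -> L2 h ->
  L2dot mu f h =
    ((norm2 (fun x => f x + h x) - norm2 f - norm2 h) / 2) +i*
    ((norm2 (fun x => f x + 'i%C * h x) - norm2 f - norm2 h) / 2).
Proof.
move=> Lf Lh; apply: complexP; rewrite [RHS]/=; first by rewrite norm2D//; field.
have Lih := L2Z 'i%C Lh.
rewrite norm2D// norm2Z// (L2dotC Lih Lf) L2dotZl// (L2dotC Lf Lh).
by move: (L2dot mu f h) => c; rewrite /nsq !reimE /=; field.
Qed.

Lemma norm2B f h : L2 f -> L2 h ->
  norm2 (fun x => f x - h x) = norm2 f + norm2 h - 2 * Re (L2dot mu f h).
Proof.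
move=> Lf Lh; have LNh := L2Z (-1) Lh.
have -> : (fun x => f x - h x) = (fun x => f x + -1 * h x).
  by apply/funext => x; rewrite mulN1r.
rewrite norm2D// norm2Z// (L2dotC LNh Lf) L2dotZl// (L2dotC Lf Lh).
by move: (L2dot mu f h) => c; rewrite /nsq !reimE Re1 Im1; ring.
Qed.

Lemma norm2_eq0 f : L2 f -> norm2 f = 0 -> {ae mu, forall x, f x = 0}.
Proof.
move=> Lf N0.
have : (\int[mu]_x `|(nsq (f x))%:E| = 0)%E.
  under eq_integral do rewrite gee0_abs ?lee_fin ?nsq_ge0//.
  by rewrite -/(enorm2 f) enorm2E// N0.
move/(ae_eq_integral_abs mu measurableT); case: Lf => mf _.
move=> /(_ (measurable_EFin_nsq mf)); apply: filterS => x /(_ I) [].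
exact: nsq_eq0.
Qed.

Lemma ae_eq0_norm2 f : L2 f -> {ae mu, forall x, f x = 0} -> norm2 f = 0.
Proof.
move=> [mf _] f0; rewrite /norm2 /Rintegral.
rewrite (@ge0_ae_eq_integral _ _ _ mu setT _ (cst 0%E)) ?integral0//.
- exact: measurable_EFin_nsq.
- by move=> x _; rewrite lee_fin nsq_ge0.
- by apply: filterS f0 => x ->; rewrite /nsq /= expr0n /= addr0.
Qed.

Lemma ae_eq_L2dotl f f' h : L2 f -> L2 f' -> L2 h ->
  {ae mu, forall x, f x = f' x} -> L2dot mu f h = L2dot mu f' h.
Proof.
move=> Lf Lf' Lh ff'; apply: ae_eq_cint.
- exact/cintegrable_measurable/cintegrable_mul_conj.
- exact/cintegrable_measurable/cintegrable_mul_conj.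
- by apply: filterS ff' => x ->.
Qed.

Lemma ae_eq_L2dotr f h h' : L2 f -> L2 h -> L2 h' ->
  {ae mu, forall x, h x = h' x} -> L2dot mu f h = L2dot mu f h'.
Proof.
move=> Lf Lh Lh' hh'.
by rewrite (L2dotC Lh Lf) (L2dotC Lh' Lf) (ae_eq_L2dotl Lh Lh' Lf).
Qed.

(** If [norm2 h] vanishes, [h] may be replaced by the zero function; otherwise the squared norm of
    [f] minus its projection on the line of [h] is nonnegative, and expanding it gives the bound. *)
Lemma L2dot_cauchy_schwarz f h : L2 f -> L2 h ->
  nsq (L2dot mu f h) <= norm2 f * norm2 h.
Proof.
move=> Lf Lh; have [h0|h0] := eqVneq (norm2 h) 0.
  rewrite h0 mulr0 (ae_eq_L2dotr Lf Lh L2_0); last exact: norm2_eq0.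
  rewrite (_ : L2dot _ _ _ = 0); first by rewrite /nsq /= expr0n /= addr0.
  rewrite (L2dotC L2_0 Lf) (_ : (fun _ : T => 0) = (fun x => 0 * f x)); last first.
    by apply/funext => x; rewrite mul0r.
  by rewrite L2dotZl// mul0r conjC0.
have hp : 0 < norm2 h by rewrite lt_neqAle eq_sym h0 norm2_ge0.
have := norm2_ge0 (fun x => f x - L2dot mu f h * ((norm2 h)^-1)%:C * h x).
have Lbh := L2Z (L2dot mu f h * ((norm2 h)^-1)%:C) Lh.
rewrite norm2B// norm2Z// (L2dotC Lbh Lf) L2dotZl// (L2dotC Lf Lh).
move: (L2dot mu f h) => c.
rewrite nsqM nsq_real !reimE Re_real Im_real.
have -> : norm2 f + nsq c * (norm2 h)^-1 ^+ 2 * norm2 h -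
    2 * ((Re c * (norm2 h)^-1 - Im c * 0) * Re c -
         (Re c * 0 + Im c * (norm2 h)^-1) * - Im c) =
    norm2 f - nsq c / norm2 h by rewrite /nsq; field.
by rewrite subr_ge0 ler_pdivrMr.
Qed.

Lemma norm2_parallelogram f h : L2 f -> L2 h ->
  norm2 (fun x => f x + h x) + norm2 (fun x => f x - h x) =
  2 * norm2 f + 2 * norm2 h.
Proof. by move=> Lf Lh; rewrite norm2D// norm2B//; ring. Qed.

End square_integrable.

(** * Fourier transforms on product measures *)

Section fubini_sigma_prod.
Context d1 d2 (T1 : measurableType d1) (T2 : measurableType d2) (R : realType).
Variable m1 : {sigma_finite_measure set T1 -> \bar R}.
Variable m2 : {sigma_finite_measure set T2 -> \bar R}.

Lemma tonelli_sigma_prod1 (f : T1 * T2 -> \bar R) : measurable_fun setT f ->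
  (forall z, (0 <= f z)%E) ->
  (\int[sigma_prod m1 m2]_z f z = \int[m1]_x \int[m2]_y f (x, y))%E.
Proof. exact: (@fubini_tonelli1 _ _ _ _ _ m1 m2). Qed.

Lemma tonelli_sigma_prod2 (f : T1 * T2 -> \bar R) : measurable_fun setT f ->
  (forall z, (0 <= f z)%E) ->
  (\int[sigma_prod m1 m2]_z f z = \int[m2]_y \int[m1]_x f (x, y))%E.
Proof. exact: (@fubini_tonelli2 _ _ _ _ _ m1 m2). Qed.

(** Tonelli gives measurability for the positive and the negative part separately; [fine] of their
    difference is then measurable, and a slice that is not integrable merely contributes the default
    values of [-] and [fine]. *)
Lemma measurable_Rintegral (f : T1 * T2 -> R) : measurable_fun setT f ->
  measurable_fun setT (fun x => \int[m2]_y f (x, y)).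
Proof.
move=> mf; apply: (measurableT_comp (fine_measurable measurableT)).
have mE : measurable_fun setT (EFin \o f) by exact/measurable_EFinP.
rewrite [X in measurable_fun _ X](_ : _ = fun x =>
    (fubini_F m2 (EFin \o f)^\+ x - fubini_F m2 (EFin \o f)^\- x)%E); last first.
  by apply/funext => x; rewrite [LHS]integralE /fubini_F; congr (_ - _)%E;
    apply: eq_integral => y _; rewrite ?funeposE ?funenegE.
apply: emeasurable_funB; apply: measurable_fun_fubini_tonelli_F => //.
  exact: measurable_funepos.
exact: measurable_funeneg.
Qed.

Lemma cmeasurable_cint (f : T1 * T2 -> R[i]) : cmeasurable f ->
  cmeasurable (fun x => cint m2 (fun y => f (x, y))).
Proof.
by move=> [f1 f2]; split; [exact: measurable_Rintegral f1|exact: measurable_Rintegral f2].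
Qed.

(** [fine] alters the inner integral only where it is infinite, which is a null set when [f] is
    integrable. *)
Lemma ae_eq_fine_fubini (f : T1 * T2 -> R) :
  (sigma_prod m1 m2).-integrable setT (EFin \o f) ->
  {ae m1, forall x, (\int[m2]_y f (x, y))%:E = fubini_F m2 (EFin \o f) x}.
Proof.
move=> /integrable_fubini_F /(integrable_ae measurableT).
by apply: filterS => x /(_ I) fx; rewrite /Rintegral fineK.
Qed.

Lemma integrable_Rintegral (f : T1 * T2 -> R) :
  (sigma_prod m1 m2).-integrable setT (EFin \o f) ->
  m1.-integrable setT (EFin \o (fun x => \int[m2]_y f (x, y))).
Proof.
move=> if_; have /integrableP[mF Foo] := integrable_fubini_F if_.
have mf : measurable_fun setT (EFin \o (fun x => \int[m2]_y f (x, y))).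
  apply/measurable_EFinP/measurable_Rintegral/measurable_EFinP.
  by case/integrableP: if_.
apply/integrableP; split => //.
rewrite (@ge0_ae_eq_integral _ _ _ m1 setT _ (abse \o fubini_F m2 (EFin \o f)))//.
- exact: measurableT_comp.
- exact: measurableT_comp.
- by move=> x _; exact: abse_ge0.
- by apply: filterS (ae_eq_fine_fubini if_) => x xE _; exact: (congr1 abse xE).
Qed.

Lemma Rintegral_sigma_prod (f : T1 * T2 -> R) :
  (sigma_prod m1 m2).-integrable setT (EFin \o f) ->
  \int[sigma_prod m1 m2]_z f z = \int[m1]_x \int[m2]_y f (x, y).
Proof.
move=> if_; rewrite /Rintegral; congr fine.
have := integral12_prod_meas1 if_; rewrite /= => <-.
apply: ae_eq_integral => //.
- by case/integrableP: (integrable_fubini_F if_).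
- by case/integrableP: (integrable_Rintegral if_).
- by apply: filterS (ae_eq_fine_fubini if_) => x xE _; exact: (esym xE).
Qed.

Lemma cintegrable_cint (f : T1 * T2 -> R[i]) : cintegrable (sigma_prod m1 m2) f ->
  cintegrable m1 (fun x => cint m2 (fun y => f (x, y))).
Proof.
by move=> [f1 f2]; split; [exact: integrable_Rintegral f1|exact: integrable_Rintegral f2].
Qed.

Lemma cint_sigma_prod (f : T1 * T2 -> R[i]) : cintegrable (sigma_prod m1 m2) f ->
  cint (sigma_prod m1 m2) f = cint m1 (fun x => cint m2 (fun y => f (x, y))).
Proof.
by move=> [f1 f2]; apply: complexP; rewrite /cint /= Rintegral_sigma_prod.
Qed.

Lemma ae_cintegrable (f : T1 * T2 -> R[i]) : cintegrable (sigma_prod m1 m2) f ->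
  {ae m1, forall x, cintegrable m2 (fun y => f (x, y))}.
Proof.
by move=> [/ae_integrable1 f1 /ae_integrable1 f2]; apply: filterS2 f1 f2.
Qed.

End fubini_sigma_prod.

Section fourier_transform.
Context d (T : measurableType d) (R : realType).
Variable mu : {sigma_finite_measure set T -> \bar R}.
Variable phi : T -> T -> R.

(** The phase is abstract so that the line, R^n, products and H^n are instances of one
    definition. *)
Definition ft (h : T -> R[i]) : T -> R[i] :=
  fun q => cint mu (fun x => h x * cexpi (- phi q x)).

(** As a property of the pair of measure and phase it can be transferred to products and images.
    With [enorm2], square integrability of the transform is part of the conclusion. *)
Definition plancherel : Prop := forall h, cintegrable mu h -> L2 mu h ->
  enorm2 mu (ft h) = enorm2 mu h.

Hypothesis mphi : measurable_fun setT (fun z : T * T => phi z.1 z.2).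

Lemma measurable_phase q : measurable_fun setT (phi q).
Proof. exact: (measurableT_comp mphi (pair1_measurable q)). Qed.

Lemma cmeasurable_ft h : cmeasurable h -> cmeasurable (ft h).
Proof.
move=> mh; pose f (z : T * T) := h z.2 * cexpi (- phi z.1 z.2).
apply: (@cmeasurable_cint _ _ _ _ _ mu f); apply: cmeasurableM.
  exact: (cmeasurable_comp mh measurable_snd).
exact/cmeasurable_cexpi/measurable_funN.
Qed.

Lemma cabs_cexpi (a : R) : cabs (cexpi a) = 1.
Proof. by rewrite cabsE nsq_cexpi sqrtr1. Qed.

Lemma cintegrable_phase h q : cintegrable mu h ->
  cintegrable mu (fun x => h x * cexpi (- phi q x)).
Proof.
move=> ih; apply: (@cintegrable_bounded _ _ _ _ _ _ 1) => //.
  exact/cmeasurable_cexpi/measurable_funN/measurable_phase.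
by move=> x; rewrite cabs_cexpi.
Qed.

Lemma ftD f h : cintegrable mu f -> cintegrable mu h ->
  ft (fun x => f x + h x) = (fun q => ft f q + ft h q).
Proof.
move=> if_ ih; apply/funext => q.
rewrite /ft -cintD; [|exact: cintegrable_phase..].
by apply: eq_cint => x; rewrite mulrDl.
Qed.

Lemma ftZ (a : R[i]) h : cintegrable mu h ->
  ft (fun x => a * h x) = (fun q => a * ft h q).
Proof.
move=> ih; apply/funext => q; rewrite /ft -cintZ; last exact: cintegrable_phase.
by apply: eq_cint => x; rewrite mulrA.
Qed.

End fourier_transform.

Section plancherel_product.
Context d1 d2 (T1 : measurableType d1) (T2 : measurableType d2) (R : realType).
Variable m1 : {sigma_finite_measure set T1 -> \bar R}.
Variable m2 : {sigma_finite_measure set T2 -> \bar R}.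
Variables (phi1 : T1 -> T1 -> R) (phi2 : T2 -> T2 -> R).
Hypothesis mphi1 : measurable_fun setT (fun z : T1 * T1 => phi1 z.1 z.2).
Hypothesis mphi2 : measurable_fun setT (fun z : T2 * T2 => phi2 z.1 z.2).

Definition phase_sum (q x : T1 * T2) : R := phi1 q.1 x.1 + phi2 q.2 x.2.

Lemma measurable_phase_sum :
  measurable_fun setT (fun z : (T1 * T2) * (T1 * T2) => phase_sum z.1 z.2).
Proof.
pose u (z : (T1 * T2) * (T1 * T2)) := (z.1.1, z.2.1).
pose v (z : (T1 * T2) * (T1 * T2)) := (z.1.2, z.2.2).
have mu : measurable_fun setT u.
  apply: measurable_fun_pair; first exact: (measurableT_comp measurable_fst measurable_fst).
  exact: (measurableT_comp measurable_fst measurable_snd).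
have mv : measurable_fun setT v.
  apply: measurable_fun_pair; first exact: (measurableT_comp measurable_snd measurable_fst).
  exact: (measurableT_comp measurable_snd measurable_snd).
apply: measurable_funD; first exact: (measurableT_comp mphi1 mu).
exact: (measurableT_comp mphi2 mv).
Qed.

Let mu := sigma_prod m1 m2.

Lemma enorm2_sigma_prod1 (h : T1 * T2 -> R[i]) : cmeasurable h ->
  enorm2 mu h = (\int[m1]_x enorm2 m2 (fun y => h (x, y)))%E.
Proof.
move=> mh; rewrite /enorm2 tonelli_sigma_prod1//; first exact: measurable_EFin_nsq.
by move=> z; rewrite lee_fin nsq_ge0.
Qed.

Lemma enorm2_sigma_prod2 (h : T1 * T2 -> R[i]) : cmeasurable h ->
  enorm2 mu h = (\int[m2]_y enorm2 m1 (fun x => h (x, y)))%E.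
Proof.
move=> mh; rewrite /enorm2 tonelli_sigma_prod2//; first exact: measurable_EFin_nsq.
by move=> z; rewrite lee_fin nsq_ge0.
Qed.

Lemma measurable_enorm2_1 (h : T1 * T2 -> R[i]) : cmeasurable h ->
  measurable_fun setT (fun x => enorm2 m2 (fun y => h (x, y))).
Proof.
move=> mh; apply: (@measurable_fun_fubini_tonelli_F _ _ _ _ _ m2 (fun z => (nsq (h z))%:E)).
  exact: measurable_EFin_nsq.
by move=> z; rewrite lee_fin nsq_ge0.
Qed.

Lemma measurable_enorm2_2 (h : T1 * T2 -> R[i]) : cmeasurable h ->
  measurable_fun setT (fun y => enorm2 m1 (fun x => h (x, y))).
Proof.
move=> mh; apply: (@measurable_fun_fubini_tonelli_G _ _ _ _ _ m1 (fun z => (nsq (h z))%:E)).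
  exact: measurable_EFin_nsq.
by move=> z; rewrite lee_fin nsq_ge0.
Qed.

Lemma ae_L2_1 (h : T1 * T2 -> R[i]) : L2 mu h ->
  {ae m1, forall x, L2 m2 (fun y => h (x, y))}.
Proof.
move=> [mh hoo]; move: hoo; rewrite enorm2_sigma_prod1// => hoo.
have /(integrable_ae measurableT) : m1.-integrable setT
    (fun x => enorm2 m2 (fun y => h (x, y))).
  apply/integrableP; split; first exact: measurable_enorm2_1.
  by under eq_integral do rewrite gee0_abs ?enorm2_ge0//.
apply: filterS => x /(_ I); rewrite ge0_fin_numE ?enorm2_ge0// => hx.
by split => //; exact: (cmeasurable_comp mh (pair1_measurable x)).
Qed.

Lemma ae_L2_2 (h : T1 * T2 -> R[i]) : L2 mu h ->
  {ae m2, forall y, L2 m1 (fun x => h (x, y))}.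
Proof.
move=> [mh hoo]; move: hoo; rewrite enorm2_sigma_prod2// => hoo.
have /(integrable_ae measurableT) : m2.-integrable setT
    (fun y => enorm2 m1 (fun x => h (x, y))).
  apply/integrableP; split; first exact: measurable_enorm2_2.
  by under eq_integral do rewrite gee0_abs ?enorm2_ge0//.
apply: filterS => x /(_ I); rewrite ge0_fin_numE ?enorm2_ge0// => hx.
by split => //; exact: (cmeasurable_comp mh (pair2_measurable x)).
Qed.

(* [g] is the partial transform in the second variable; for almost every value
   of the other variable each of the two partial transforms is an isometry *)
Lemma plancherel_sigma_prod : plancherel m1 phi1 -> plancherel m2 phi2 ->
  plancherel mu phase_sum.
Proof.
move=> P1 P2 h ih Lh; have mh := cintegrable_measurable ih.
pose g (z : T1 * T2) := ft m2 phi2 (fun y => h (z.1, y)) z.2.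
have mg : cmeasurable g.
  pose f (w : (T1 * T2) * T2) := h (w.1.1, w.2) * cexpi (- phi2 w.1.2 w.2).
  apply: (@cmeasurable_cint _ _ _ _ _ m2 f); apply: cmeasurableM.
    apply: (@cmeasurable_comp _ _ _ _ _ h (fun w : (T1 * T2) * T2 => (w.1.1, w.2))) => //.
    apply: measurable_fun_pair => //.
    exact: (measurableT_comp measurable_fst measurable_fst).
  apply/cmeasurable_cexpi/measurable_funN.
  apply: (measurableT_comp mphi2
    (_ : measurable_fun _ (fun w : (T1 * T2) * T2 => (w.1.2, w.2)))).
  apply: measurable_fun_pair => //.
  exact: (measurableT_comp measurable_snd measurable_fst).
have Eg : enorm2 mu g = enorm2 mu h.
  rewrite (enorm2_sigma_prod1 mg) (enorm2_sigma_prod1 mh).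
  apply: ge0_ae_eq_integral => //.
  - exact: measurable_enorm2_1.
  - exact: measurable_enorm2_1.
  - by move=> x _; exact: enorm2_ge0.
  - by move=> x _; exact: enorm2_ge0.
  - have ae1 := ae_cintegrable ih; have ae2 := ae_L2_1 Lh.
    move: ae1 ae2; apply: filterS2 => x ihx Lhx _.
    exact: (P2 (fun y => h (x, y)) ihx Lhx).
have Lg : L2 mu g by split => //; rewrite Eg; case: Lh.
have ih2 q2 : cintegrable mu (fun z => h z * cexpi (- phi2 q2 z.2)).
  apply: (@cintegrable_bounded _ _ _ _ _ _ 1) => //.
    apply/cmeasurable_cexpi/measurable_funN.
    exact: (measurableT_comp (measurable_phase mphi2 q2) measurable_snd).
  by move=> x; rewrite cabs_cexpi.
have ig q2 : cintegrable m1 (fun x => g (x, q2)).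
  exact: (cintegrable_cint (ih2 q2)).
(* The phase in x leaves the inner integral wherever the slice of [h] is integrable, that is for
   almost every x; the outer integral does not see the exceptional set. *)
have ftE q1 q2 : ft mu phase_sum h (q1, q2) = ft m1 phi1 (fun x => g (x, q2)) q1.
  rewrite /ft cint_sigma_prod; last first.
    exact: (cintegrable_phase measurable_phase_sum).
  apply: ae_eq_cint.
  - pose f z := h z * cexpi (- phase_sum (q1, q2) z).
    apply: (@cmeasurable_cint _ _ _ _ _ m2 f); apply: cmeasurableM => //.
    apply: cmeasurable_cexpi; apply: measurable_funN.
    exact: (measurable_phase measurable_phase_sum (q1, q2)).
  - apply: cmeasurableM; first exact: cintegrable_measurable (ig q2).
    apply: cmeasurable_cexpi; apply: measurable_funN.
    exact: (measurable_phase mphi1 q1).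
  - apply: filterS (ae_cintegrable ih) => x ihx.
    rewrite mulrC /g /ft -cintZ; last exact: (cintegrable_phase mphi2).
    apply: eq_cint => y /=.
    by rewrite /phase_sum opprD cexpiD; ring.
rewrite (enorm2_sigma_prod2 (cmeasurable_ft _ measurable_phase_sum mh)).
rewrite -Eg (enorm2_sigma_prod2 mg); apply: ge0_ae_eq_integral => //.
- exact/measurable_enorm2_2/(cmeasurable_ft _ measurable_phase_sum).
- exact: measurable_enorm2_2.
- by move=> x _; exact: enorm2_ge0.
- by move=> x _; exact: enorm2_ge0.
(* [ig] gives integrability of the slice of [g] for every [q2]; square integrability holds for
   almost every one, which suffices under the outer integral. *)
- apply: filterS (ae_L2_2 Lg) => q2 Lgq _.
  under eq_fun do rewrite ftE.
  exact: (P1 (fun x => g (x, q2)) (ig q2) Lgq).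
Qed.

End plancherel_product.

Section plancherel_pushforward.
Context d1 d2 (T1 : measurableType d1) (T2 : measurableType d2) (R : realType).
Variable m1 : {sigma_finite_measure set T1 -> \bar R}.
Variable m2 : {sigma_finite_measure set T2 -> \bar R}.
Variables (u : T1 -> T2).
Hypothesis mu : measurable_fun setT u.
Hypothesis m2E : m2 = pushforward m1 u :> (set T2 -> \bar R).

Lemma ge0_integral_pushforwardT (f : T2 -> \bar R) : measurable_fun setT f ->
  (forall y, (0 <= f y)%E) -> (\int[m2]_y f y = \int[m1]_x f (u x))%E.
Proof.
move=> mf f0; rewrite m2E.
by rewrite (ge0_integral_pushforward mu m1 measurableT)// => y _; exact: f0.
Qed.

Lemma Rintegral_pushforwardT (f : T2 -> R) : measurable_fun setT f ->
  \int[m2]_y f y = \int[m1]_x f (u x).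
Proof.
move=> mf; rewrite /Rintegral; congr fine.
have mE : measurable_fun setT (EFin \o f) by exact/measurable_EFinP.
rewrite integralE [RHS]integralE; congr (_ - _)%E;
  rewrite ge0_integral_pushforwardT//;
  try by apply: eq_integral => x _; rewrite ?funeposE ?funenegE.
  exact: measurable_funepos.
exact: measurable_funeneg.
Qed.

Lemma cint_pushforward (f : T2 -> R[i]) : cmeasurable f ->
  cint m2 f = cint m1 (f \o u).
Proof. by move=> [f1 f2]; apply: complexP => /=; exact: Rintegral_pushforwardT. Qed.

(** Since [u] carries one phase to the other, the transform commutes with composition by [u], and
    both norms are computed upstairs by change of variables. With [tuple_cons] this passes from R *
    R^n to R^(n+1). *)
Lemma plancherel_pushforward (phi1 : T1 -> T1 -> R) (phi2 : T2 -> T2 -> R) :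
  measurable_fun setT (fun z : T2 * T2 => phi2 z.1 z.2) ->
  (forall q x, phi2 (u q) (u x) = phi1 q x) ->
  plancherel m1 phi1 -> plancherel m2 phi2.
Proof.
move=> mphi2 phiE P1 h ih Lh; have mh := cintegrable_measurable ih.
have E f : cmeasurable f -> enorm2 m2 f = enorm2 m1 (f \o u).
  move=> mf; apply: ge0_integral_pushforwardT; first exact: measurable_EFin_nsq.
  by move=> y; rewrite lee_fin nsq_ge0.
rewrite !E//; last exact: (cmeasurable_ft _ mphi2).
have mhu : cmeasurable (h \o u) by exact: cmeasurable_comp.
rewrite -(P1 (h \o u)); last 2 first.
- move/cintegrable_cabsP : ih => [_ hoo]; apply/cintegrable_cabsP; split => //.
  have mch : measurable_fun setT (fun y => (cabs (h y))%:E).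
    by apply/measurable_EFinP; exact: measurable_cabs.
  have ch0 y : (0 <= (cabs (h y))%:E)%E by rewrite lee_fin cabs_ge0.
  by move: hoo; rewrite (ge0_integral_pushforwardT mch ch0).
- by split => //; rewrite -E//; case: Lh.
apply: eq_integral => q _; congr ((nsq _)%:E).
rewrite /= /ft cint_pushforward; last first.
  apply: cmeasurableM => //.
  apply: cmeasurable_cexpi; apply: measurable_funN.
  exact: (measurable_phase mphi2).
by apply: eq_cint => x /=; rewrite phiE.
Qed.

End plancherel_pushforward.

(** * The Poisson kernel *)

Section lebesgue_translation.
Context {R : realType}.
Local Notation mu := (@lebesgue_measure R).
Local Notation RT := (measurableTypeR R).

Lemma measurable_shift (a : R) : measurable_fun setT (fun x : RT => x + a : RT).
Proof. by apply: (@measurable_funD _ RT R setT (fun x => x) (fun=> a)). Qed.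

(** Lebesgue measure is determined by its values on half-open intervals, whose length a shift
    preserves. *)
Lemma lebesgue_measure_shift (a : R) (A : set RT) : measurable A ->
  mu A = pushforward mu (fun x : RT => x + a : RT) A.
Proof.
move=> mA; apply: lebesgue_measure_unique => //=; first exact: measurable_shift.
move=> mshift _ [[x y]] _ <-.
rewrite /= /pushforward.
have -> : (fun z : R => z + a) @^-1` `]x, y]%classic = `]x - a, y - a]%classic.
  by apply/seteqP; split => z /=; rewrite !in_itv/= ltrBlDr lerBrDr.
rewrite !lebesgue_measure_itv/= !lte_fin ltrD2r.
by case: ifP => // _; rewrite -!EFinD; congr EFin; ring.
Qed.

Lemma ge0_integral_shift (a : R) (f : RT -> \bar R) : measurable_fun setT f ->
  (forall x, (0 <= f x)%E) -> (\int[mu]_x f (x + a)%R = \int[mu]_x f x)%E.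
Proof.
move=> mf f0.
rewrite -(@ge0_integral_pushforward _ _ _ _ _ _ (measurable_shift a) mu setT f)//.
apply: eq_measure_integral => /=; first exact: measurable_shift.
by move=> mshift A mA _; exact/esym/lebesgue_measure_shift.
Qed.
End lebesgue_translation.

Section poisson_kernel.
Context {R : realType}.
Local Notation mu := (@lebesgue_measure R).
Local Notation RT := (measurableTypeR R).

Lemma cvg_expR_bounded (a : R) (u : R -> R) (C : R) : 0 < a ->
  (forall q, `|u q| <= C) -> expR (- (a * q)) * u q @[q --> +oo] --> (0 : R).
Proof.
move=> a0 uC.
have e0 : expR (- (a * q)) @[q --> +oo] --> (0 : R).
  apply: (@cvg_comp _ _ _ (fun q => a * q) (fun z => expR (- z)) _ (pinfty_nbhs R)).
    exact: gt0_cvgMry.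
  exact: cvgr_expR.
have C0 : 0 <= C by apply: le_trans (uC 0).
have eC0 : C * expR (- (a * q)) @[q --> +oo] --> (0 : R).
  by rewrite -(mulr0 C); apply: cvgM => //; exact: cvg_cst.
have eCN0 : - (C * expR (- (a * q))) @[q --> +oo] --> (0 : R).
  by rewrite -oppr0; exact: cvgN.
apply: squeeze_cvgr eCN0 eC0; near=> q.
rewrite -ler_norml normrM ger0_norm ?expR_ge0// mulrC.
by rewrite ler_wpM2r ?expR_ge0.
Unshelve. all: by end_near. Qed.

(** The cosine is raised by 1 to make the integrand nonnegative, as the fundamental theorem of
    calculus on a half-line requires. *)
Lemma integral_exp_cos_half (a b : R) : 0 < a ->
  (\int[mu]_(q in `[0%R, +oo[) (expR (- (a * q)) * (1 + cos (b * q)))%:E =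
   (a^-1 + a / (a ^+ 2 + b ^+ 2))%:E)%E.
Proof.
move=> a0; have ab0 : a ^+ 2 + b ^+ 2 != 0.
  by rewrite gt_eqF// ltr_pwDl ?exprn_gt0// sqr_ge0.
(* A primitive that vanishes at infinity, so that the integral is [- F 0]. *)
pose F q := expR (- (a * q)) *
  (- a^-1 + (b * sin (b * q) - a * cos (b * q)) / (a ^+ 2 + b ^+ 2)).
have dF (x : R) : is_derive x 1 F (expR (- (a * x)) * (1 + cos (b * x))).
  apply: is_derive_eq; rewrite /GRing.scale /=.
  by field; rewrite ab0 gt_eqF.
have cF : continuous F.
  by move=> x; apply/differentiable_continuous/derivable1_diffP; case: (dF x).
rewrite (@ge0_continuous_FTC2y _ _ F 0 0).
- rewrite -EFinB; congr EFin; rewrite /F !mulr0 oppr0 expR0 sin0 cos0; field.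
  by rewrite ab0 gt_eqF.
- by move=> x _; rewrite mulr_ge0 ?expR_ge0// -lerBlDl sub0r cos_geN1.
- apply: continuous_subspaceT => x; apply/differentiable_continuous/derivable1_diffP.
  exact: ex_derive.
- apply: (@cvg_expR_bounded a _ (a^-1 + (`|b| + a) / (a ^+ 2 + b ^+ 2))) => // q.
  apply: (le_trans (ler_normD _ _)); rewrite normrN (ger0_norm (ltW _)) ?invr_gt0//.
  rewrite lerD2l normrM (ger0_norm (x := _^-1)) ?invr_ge0 ?addr_ge0 ?sqr_ge0//.
  rewrite ler_wpM2r ?invr_ge0 ?addr_ge0 ?sqr_ge0//.
  apply: (le_trans (ler_normB _ _)); rewrite !normrM; apply: lerD.
    by rewrite ler_piMr// ler_norml sin_geN1 sin_le1.
  by rewrite (gtr0_norm a0) ler_piMr ?(ltW a0)// ler_norml cos_geN1 cos_le1.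
- by move=> x _; case: (dF x).
- exact: cvg_at_right_filter (cF 0).
- by move=> x _; rewrite derive1E; case: (dF x).
Qed.

Definition abel (a q : R) : R := expR (- (a * `|q|)).

Lemma abel_ge0 a q : 0 <= abel a q. Proof. exact: expR_ge0. Qed.

Lemma continuous_abel a : continuous (abel a).
Proof.
move=> q; apply: (@continuous_comp _ _ _ (fun q => - (a * `|q|)) expR).
  apply: cvgN; apply: cvgM; [exact: cvg_cst|exact: norm_continuous].
exact: continuous_expR.
Qed.

Lemma measurable_abel a : measurable_fun setT (abel a).
Proof. apply: continuous_measurable_fun; exact: continuous_abel. Qed.

Lemma continuous_cosM (b : R) : continuous (fun q => cos (b * q)).
Proof.
move=> q; apply: (@continuous_comp _ _ _ (fun q => b * q) (@cos R)).
  exact: mulrl_continuous.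
exact: continuous_cos.
Qed.

Lemma continuous_sinM (b : R) : continuous (fun q => sin (b * q)).
Proof.
move=> q; apply: (@continuous_comp _ _ _ (fun q => b * q) (@sin R)).
  exact: mulrl_continuous.
exact: continuous_sin.
Qed.

Lemma integral_abel_1cos (a b : R) : 0 < a ->
  (\int[mu]_q (abel a q * (1 + cos (b * q)))%:E =
   (2 * (a^-1 + a / (a ^+ 2 + b ^+ 2)))%:E)%E.
Proof.
move=> a0; rewrite ge0_symfun_integralT.
- rewrite EFinM -(integral_exp_cos_half b a0) -set_itvcy.
  apply: (congr1 (fun x => 2%:E * x)%E).
  apply: eq_integral => q; rewrite inE/= in_itv/= andbT => q0.
  by rewrite /abel ger0_norm.
- by move=> q; rewrite mulr_ge0 ?abel_ge0// -lerBlDl sub0r cos_geN1.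
- move=> q; apply: cvgM; first exact: continuous_abel.
  by apply: cvgD; [exact: cvg_cst|exact: continuous_cosM].
- by move=> q; rewrite /= /abel normrN mulrN cosN.
Qed.

(** The case b = 0 of the preceding formula, where [1 + cos] is the constant 2. *)
Lemma integral_abel (a : R) : 0 < a -> (\int[mu]_q (abel a q)%:E = (2 / a)%:E)%E.
Proof.
move=> a0; have := integral_abel_1cos 0 a0.
under eq_integral do rewrite mul0r cos0 mulrC EFinM.
rewrite ge0_integralZl//.
- move=> /(congr1 (fun x => (2^-1)%:E * x)%E); rewrite muleA -EFinM -!EFinM.
  have -> : 2^-1 * (1 + 1) = 1 :> R by field.
  by rewrite mul1e => ->; congr EFin; field; rewrite gt_eqF.
- by apply/measurable_EFinP; exact: measurable_abel.
- by move=> x _; rewrite lee_fin abel_ge0.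
Qed.

Lemma integrable_abel (a : R) : 0 < a -> mu.-integrable setT (EFin \o abel a).
Proof.
move=> a0; apply/integrableP; split.
  by apply/measurable_EFinP; exact: measurable_abel.
under eq_integral do rewrite /= ger0_norm ?abel_ge0//.
by rewrite integral_abel// ltry.
Qed.

Lemma integrable_abelM (a : R) (u : R -> R) : 0 < a -> measurable_fun setT u ->
  (forall q, `|u q| <= 1) -> mu.-integrable setT (EFin \o (fun q => abel a q * u q)).
Proof.
move=> a0 mu_ u1; apply: le_integrable (integrable_abel a0) => //.
  by apply/measurable_EFinP; apply: measurable_funM => //; exact: measurable_abel.
move=> q _ /=; rewrite lee_fin normrM ler_piMr//.
Qed.

(** Once the weight alone is known to be integrable, the 1 added for positivity can be subtracted
    again. *)
Lemma Rintegral_abel_cos (a b : R) : 0 < a ->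
  \int[mu]_q (abel a q * cos (b * q)) = 2 * a / (a ^+ 2 + b ^+ 2).
Proof.
move=> a0; have ic : mu.-integrable setT (EFin \o (fun q => abel a q * cos (b * q))).
  apply: integrable_abelM => //.
    by apply: continuous_measurable_fun; exact: continuous_cosM.
  by move=> q; rewrite ler_norml cos_geN1 cos_le1.
have := congr1 fine (integral_abel_1cos b a0); rewrite -/(Rintegral _ _ _) /=.
under eq_Rintegral do rewrite mulrDr mulr1.
rewrite RintegralD//; last exact: integrable_abel.
rewrite {1}/Rintegral integral_abel//=.
set X := (X in _ + X = _ -> _) => E; rewrite -[LHS]/X.
have -> : X = 2 / a + X - 2 / a by ring.
by rewrite E; ring.
Qed.

(** Lebesgue measure is invariant under negation, so the integral equals its own opposite. *)
Lemma Rintegral_odd (u : RT -> R) : mu.-integrable setT (EFin \o u) ->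
  (forall q, u (- q) = - u q) -> \int[mu]_q u q = 0.
Proof.
move=> iu uN.
have mN : measurable_fun setT (fun x : RT => - x : RT) by exact: oppr_measurable.
have mu_ : measurable_fun setT (EFin \o u) by case/integrableP: iu.
have iuN : mu.-integrable setT (EFin \o (fun q => - u q)).
  by apply: eq_integrable (integrableN iu) => // q _ /=; rewrite EFinN.
have E : (\int[mu]_q (u q)%:E = \int[mu]_q (- u q)%R%:E)%E.
  transitivity (\int[pushforward mu (fun x : RT => (- x)%R : RT)]_q (u q)%:E)%E.
    apply: eq_measure_integral => /= A mA _; exact/esym/lebesgue_measureN.
  rewrite integral_pushforward//=; last first.
    by apply: eq_integrable iuN => // q _ /=; rewrite uN.
  by apply: eq_integral => q _ /=; rewrite uN.
have : \int[mu]_q u q = - \int[mu]_q u q.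
  rewrite {1}/Rintegral E -/(Rintegral mu setT (fun q => - u q)).
  rewrite -[RHS]mulN1r -RintegralZl//; apply: eq_Rintegral => q _.
  by rewrite mulN1r.
move/eqP; rewrite -addr_eq0 -mulr2n -mulr_natl mulf_eq0 => /orP[|/eqP//].
by rewrite pnatr_eq0.
Qed.

Lemma Rintegral_abel_sin (a b : R) : 0 < a ->
  \int[mu]_q (abel a q * sin (b * q)) = 0.
Proof.
move=> a0; apply: Rintegral_odd.
  apply: integrable_abelM => //.
    by apply: continuous_measurable_fun; exact: continuous_sinM.
  by move=> q; rewrite ler_norml sin_geN1 sin_le1.
by move=> q; rewrite /abel normrN mulrN sinN mulrN.
Qed.

(** The Poisson kernel of the upper half-plane at height [s]: it is the Fourier transform of
    [abel (2 * pi * s)], and [atan (z / s) / pi] is its primitive. *)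
Definition poisson (s z : R) : R := s / (pi * (s ^+ 2 + z ^+ 2)).

Lemma poisson_ge0 s z : 0 <= s -> 0 <= poisson s z.
Proof.
by move=> s0; rewrite divr_ge0// mulr_ge0 ?pi_ge0// addr_ge0 ?sqr_ge0.
Qed.

Lemma poisson_gt0_den (s z : R) : 0 < s -> 0 < s ^+ 2 + z ^+ 2.
Proof. by move=> s0; rewrite ltr_pwDl ?exprn_gt0// sqr_ge0. Qed.

Lemma poissonN s z : poisson s (- z) = poisson s z.
Proof. by rewrite /poisson sqrrN. Qed.

(** The sine part is odd and drops out; in the cosine part, a = 2 pi s and b = 2 pi t turn 2 a /
    (a^2 + b^2) into [poisson s t]. *)
Lemma Rintegral_abel_cexpi (s t : R) (c : R[i]) : 0 < s ->
  \int[mu]_q (abel (2 * pi * s) q * Re (c * cexpi (- (2 * pi * t * q)))) =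
  Re c * poisson s t.
Proof.
move=> s0; have a0 : 0 < 2 * pi * s by rewrite !mulr_gt0 ?pi_gt0.
set a := 2 * pi * s; set b := 2 * pi * t.
transitivity (\int[mu]_q (Re c * (abel a q * cos (b * q)) +
                           Im c * (abel a q * sin (b * q)))).
  by apply: eq_Rintegral => q _; rewrite !reimE /= cosN sinN; ring.
have ic : mu.-integrable setT (EFin \o (fun q => abel a q * cos (b * q))).
  apply: integrable_abelM => //.
    by apply: continuous_measurable_fun; exact: continuous_cosM.
  by move=> q; rewrite ler_norml cos_geN1 cos_le1.
have is_ : mu.-integrable setT (EFin \o (fun q => abel a q * sin (b * q))).
  apply: integrable_abelM => //.
    by apply: continuous_measurable_fun; exact: continuous_sinM.
  by move=> q; rewrite ler_norml sin_geN1 sin_le1.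
rewrite RintegralD//.
- rewrite !RintegralZl// Rintegral_abel_cos// Rintegral_abel_sin//.
  rewrite mulr0 addr0 /poisson /a /b; congr (_ * _).
  have st0 := poisson_gt0_den t s0; move: (@pi R) (pi_gt0 R) => p p0.
  have st1 : 0 < (2 * p * s) ^+ 2 + (2 * p * t) ^+ 2.
    rewrite (_ : _ + _ = 4 * p ^+ 2 * (s ^+ 2 + t ^+ 2)); last by ring.
    by rewrite !mulr_gt0 ?exprn_gt0.
  by field; rewrite !gt_eqF.
- exact: (integrableZl measurableT (Re c) ic).
- exact: (integrableZl measurableT (Im c) is_).
Qed.

Lemma is_derive_poisson (s y x : R) : 0 < s ->
  is_derive x 1 (fun x => atan ((x - y) / s) / pi) (poisson s (x - y)).
Proof.
move=> s0; apply: is_derive_eq; rewrite /GRing.scale /= /poisson.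
have st0 := poisson_gt0_den (x - y) s0; move: (@pi R) (pi_gt0 R) => p p0.
by field; rewrite !gt_eqF.
Qed.

Lemma continuous_poisson_primitive (s y : R) : 0 < s ->
  continuous (fun x => atan ((x - y) / s) / pi).
Proof.
move=> s0 x; apply/differentiable_continuous/derivable1_diffP.
by case: (is_derive_poisson y x s0).
Qed.

Lemma continuous_poisson (s y : R) : 0 < s -> continuous (fun x => poisson s (x - y)).
Proof.
move=> s0 x.
have cden : {for x, continuous (fun x => pi * (s ^+ 2 + (x - y) ^+ 2))}.
  by apply/differentiable_continuous/derivable1_diffP; exact: ex_derive.
apply: cvgM; first exact: cvg_cst.
by apply: cvgV; first by rewrite gt_eqF// mulr_gt0 ?pi_gt0// poisson_gt0_den.
Qed.

Lemma continuous_poisson0 (s : R) : 0 < s -> continuous (poisson s).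
Proof.
move=> s0; rewrite (_ : poisson s = (fun x => poisson s (x - 0))).
  exact: continuous_poisson.
by apply/funext => x; rewrite subr0.
Qed.

Lemma integral_poisson (s : R) : 0 < s -> (\int[mu]_x (poisson s x)%:E = 1)%E.
Proof.
move=> s0; have ks x : poisson s x = poisson s (x - 0) by rewrite subr0.
rewrite ge0_symfun_integralT.
- rewrite -set_itvcy (@ge0_continuous_FTC2y _ _ (fun x => atan ((x - 0) / s) / pi) 0 (2^-1)).
  + by rewrite subrr mul0r atan0 mul0r sube0 -EFinM divff.
  + by move=> x _; rewrite poisson_ge0// ltW.
  + by apply: continuous_subspaceT; exact: continuous_poisson0.
  (* The primitive starts at 0 and tends to (pi / 2) / pi, so each half-line carries mass 1/2. *)
  + have -> : 2^-1 = (pi / 2) / pi :> R.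
      by move: (@pi R) (pi_gt0 R) => p p0; field; rewrite gt_eqF.
    apply: cvgM; last exact: cvg_cst.
    have -> : (fun x => atan ((x - 0) / s)) = (fun x => atan (s^-1 * x)).
      by apply/funext => q; rewrite subr0 mulrC.
    apply: (@cvg_comp _ _ _ (fun q => s^-1 * q) (@atan R) _ (pinfty_nbhs R)).
      have si0 : 0 < s^-1 by rewrite invr_gt0.
      exact: gt0_cvgMry.
    exact: cvgy_atan.
  + by move=> x _; case: (is_derive_poisson 0 x s0).
  + exact: cvg_at_right_filter (@continuous_poisson_primitive s 0 s0 0).
  + by move=> x _; rewrite derive1E ks; case: (is_derive_poisson 0 x s0).
- by move=> x; rewrite poisson_ge0// ltW.
- exact: continuous_poisson0.
- by move=> x; rewrite /= poissonN.
Qed.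

Lemma measurable_poisson s : 0 < s -> measurable_fun setT (poisson s).
Proof.
by move=> s0; apply: continuous_measurable_fun; exact: continuous_poisson0.
Qed.

Lemma integral_poisson_shift (s y : R) : 0 < s ->
  (\int[mu]_x (poisson s (x - y))%:E = 1)%E.
Proof.
move=> s0; rewrite (@ge0_integral_shift _ (- y) (fun x => (poisson s x)%:E)).
- exact: integral_poisson.
- by apply/measurable_EFinP; exact: measurable_poisson.
- by move=> x; rewrite lee_fin poisson_ge0// ltW.
Qed.

Lemma integral_poisson_itv (s y a b : R) : 0 < s -> a < b ->
  (\int[mu]_(x in `]a, b]) (poisson s (x - y))%:E =
   ((atan ((b - y) / s) - atan ((a - y) / s)) / pi)%:E)%E.
Proof.
move=> s0 ab; rewrite integral_itv_obnd_cbnd; last first.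
  apply/measurable_EFinP; apply: measurable_funTS.
  apply: continuous_measurable_fun; exact: continuous_poisson.
rewrite (@continuous_FTC2 _ _ (fun x => atan ((x - y) / s) / pi))//.
- by rewrite -EFinB -mulrBl.
- by apply: continuous_subspaceT; exact: continuous_poisson.
- split.
  + by move=> x _; case: (is_derive_poisson y x s0).
  + exact: cvg_at_right_filter (@continuous_poisson_primitive s y s0 a).
  + exact: cvg_at_left_filter (@continuous_poisson_primitive s y s0 b).
- by move=> x _; rewrite derive1E; case: (is_derive_poisson y x s0).
Qed.

End poisson_kernel.

(** * Plancherel's identity on the line *)

Section tensor_product.
Context d1 d2 (T1 : measurableType d1) (T2 : measurableType d2) (R : realType).
Variable m1 : {sigma_finite_measure set T1 -> \bar R}.
Variable m2 : {sigma_finite_measure set T2 -> \bar R}.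

Lemma integrable_tensor (u : T1 -> R) (v : T2 -> R) :
  m1.-integrable setT (EFin \o u) -> m2.-integrable setT (EFin \o v) ->
  (sigma_prod m1 m2).-integrable setT (EFin \o (fun z => u z.1 * v z.2)).
Proof.
move=> iu iv.
have mu : measurable_fun setT u by apply/measurable_EFinP; case/integrableP: iu.
have mv : measurable_fun setT v by apply/measurable_EFinP; case/integrableP: iv.
have muv : measurable_fun setT (fun z : T1 * T2 => u z.1 * v z.2).
  by apply: measurable_funM; [exact: (measurableT_comp mu measurable_fst)|
                              exact: (measurableT_comp mv measurable_snd)].
apply/integrableP; split; first exact/measurable_EFinP.
rewrite tonelli_sigma_prod1//; last first.
  by apply: measurableT_comp => //; exact/measurable_EFinP.
have [_ ioou] := integrableP _ _ _ iu; have [mEv ioov] := integrableP _ _ _ iv.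
have vfin : (\int[m2]_y `|(v y)%:E| \is a fin_num)%E.
  by rewrite ge0_fin_numE// integral_ge0.
have -> : (\int[m1]_x \int[m2]_y `|(EFin \o (fun z => (u z.1 * v z.2)%R)) (x, y)| =
    \int[m1]_x (`|(u x)%:E| * \int[m2]_y `|(v y)%:E|))%E.
  apply: eq_integral => x _.
  rewrite -ge0_integralZl//; last exact: measurableT_comp.
  by apply: eq_integral => y _ /=; rewrite normrM.
rewrite -(fineK vfin) ge0_integralZr//.
- by rewrite fineK// lte_mul_pinfty// ?integral_ge0// ge0_fin_numE// integral_ge0.
- by apply: measurableT_comp => //; exact/measurable_EFinP.
- by rewrite lee_fin fine_ge0// integral_ge0.
Qed.

Lemma cintegrable_tensor (F : T1 -> R[i]) (G : T2 -> R[i]) :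
  cintegrable m1 F -> cintegrable m2 G ->
  cintegrable (sigma_prod m1 m2) (fun z => F z.1 * G z.2).
Proof.
move=> iF iG.
apply: (le_cintegrable _ (integrable_tensor (cintegrable_cabs iF) (cintegrable_cabs iG))).
  apply: cmeasurableM.
    exact: (cmeasurable_comp (cintegrable_measurable iF) measurable_fst).
  exact: (cmeasurable_comp (cintegrable_measurable iG) measurable_snd).
by move=> z /=; rewrite cabsM.
Qed.

Lemma Rintegral_sigma_prod2 (f : T1 * T2 -> R) :
  (sigma_prod m1 m2).-integrable setT (EFin \o f) ->
  \int[sigma_prod m1 m2]_z f z = \int[m2]_y \int[m1]_x f (x, y).
Proof.
move=> if_; rewrite /Rintegral; congr fine.
have := integral21_prod_meas1 if_; rewrite /= => <-.
have mG := measurable_fubini_G if_.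
have E : {ae m2, forall y, fubini_G m1 (EFin \o f) y = (\int[m1]_x f (x, y))%:E}.
  have := ae_integrable2 if_; apply: filterS => y iy.
  by rewrite /Rintegral fineK//; exact: integrable_fin_num.
apply: ae_eq_integral => //; last by apply: filterS E => y + _.
apply/measurable_EFinP.
exact: (measurableT_comp (fine_measurable measurableT) mG).
Qed.

End tensor_product.

(** The square of an integral becomes a double integral, so that a further integration over the
    frequency can be moved inside by Fubini. *)
Lemma nsq_cint d (T : measurableType d) (R : realType)
    (mu : {sigma_finite_measure set T -> \bar R}) (F : T -> R[i]) :
  cintegrable mu F ->
  nsq (cint mu F) = \int[sigma_prod mu mu]_z Re (F z.1 * (F z.2)^*).
Proof.
move=> iF; have iFc := cintegrable_conj iF.
have := cint_sigma_prod (cintegrable_tensor iF iFc).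
have -> : cint mu (fun x => cint mu (fun y => F (x, y).1 * (F (x, y).2)^*)) =
    (cint mu F)^* * cint mu F.
  rewrite -cintZ//; apply: eq_cint => x /=.
  by rewrite cintZ// cint_conj// mulrC.
move=> /(congr1 (@complex.Re R)); rewrite [X in X = _ -> _]/= => ->.
by move: (cint mu F) => c; rewrite /nsq !reimE; ring.
Qed.

Section abel_means.
Context {R : realType}.
Local Notation mu := (@lebesgue_measure R).
Local Notation RT := (measurableTypeR R).
Implicit Types h : RT -> R[i].

Definition phaseR (q x : RT) : R := 2 * pi * ((q : R) * (x : R)).

Lemma measurable_phaseR : measurable_fun setT (fun z : RT * RT => phaseR z.1 z.2).
Proof.
apply: measurable_funM; first exact: measurable_cst.
by apply: measurable_funM.
Qed.

(** The variable is (q, (x, y)). Integrating over (x, y) gives the weighted [|ft h q|^2];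
    integrating over q gives the Poisson form of [h]. *)
Definition abel_integrand (s : R) h (w : RT * (RT * RT)) : R :=
  abel (2 * pi * s) w.1 *
  Re (h w.2.1 * (h w.2.2)^* * cexpi (- (2 * pi * ((w.2.1 : R) - w.2.2) * w.1))).

(** Up to a factor of modulus at most one, this is a tensor product of three integrable functions:
    the weight, [h] and its conjugate. *)
Lemma integrable_abel_integrand s h : 0 < s -> cintegrable mu h ->
  (sigma_prod mu (sigma_prod mu mu)).-integrable setT (EFin \o abel_integrand s h).
Proof.
move=> s0 ih; have a0 : 0 < 2 * pi * s by rewrite !mulr_gt0 ?pi_gt0.
pose A (q : RT) : R[i] := (abel (2 * pi * s) q)%:C.
have iA : cintegrable mu A.
  split; first exact: integrable_abel.
  exact: integrable0.
have i1 := cintegrable_tensor iA (cintegrable_tensor ih (cintegrable_conj ih)).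
have m21 : measurable_fun setT (fun w : RT * (RT * RT) => w.2.1).
  exact: (measurableT_comp measurable_fst measurable_snd).
have m22 : measurable_fun setT (fun w : RT * (RT * RT) => w.2.2).
  exact: (measurableT_comp measurable_snd measurable_snd).
have [] := @cintegrable_bounded _ _ _ _ _
    (fun w : RT * (RT * RT) => cexpi (- (2 * pi * ((w.2.1 : R) - w.2.2) * w.1))) 1 i1.
- apply: cmeasurable_cexpi; apply: measurable_funN; apply: measurable_funM => //.
  by apply: measurable_funM => //; exact: measurable_funB.
- by move=> x; rewrite cabs_cexpi.
- have ReA q X : Re (A q * X) = abel (2 * pi * s) q * Re X.
    by rewrite cReM /A /= mul0r subr0.
  by move=> i2 _; apply: eq_integrable i2 => // w _; congr EFin; rewrite -mulrA ReA.
Qed.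

Lemma abel_nsq_ft s h q : cintegrable mu h ->
  abel (2 * pi * s) q * nsq (ft mu phaseR h q) =
  \int[sigma_prod mu mu]_z abel_integrand s h (q, z).
Proof.
move=> ih; have iF := cintegrable_phase measurable_phaseR q ih.
rewrite /ft nsq_cint// -RintegralZl//; last first.
  by have [] := cintegrable_tensor iF (cintegrable_conj iF).
apply: eq_Rintegral => z _; rewrite /abel_integrand; congr (_ * Re _) => /=.
rewrite rmorphM /= conj_cexpi opprK mulrACA -cexpiD; congr (_ * cexpi _).
by rewrite /phaseR; ring.
Qed.

Lemma integrable_abel_nsq_ft s h : 0 < s -> cintegrable mu h ->
  mu.-integrable setT (EFin \o (fun q => abel (2 * pi * s) q * nsq (ft mu phaseR h q))).
Proof.
move=> s0 ih.
apply: eq_integrable (integrable_Rintegral (integrable_abel_integrand s0 ih)) => //.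
by move=> q _ /=; rewrite abel_nsq_ft.
Qed.

(** Fubini on [abel_integrand]: the two sides are its two iterated integrals. *)
Lemma Rintegral_abel_nsq_ft s h : 0 < s -> cintegrable mu h ->
  \int[mu]_q (abel (2 * pi * s) q * nsq (ft mu phaseR h q)) =
  \int[sigma_prod mu mu]_z (Re (h z.1 * (h z.2)^*) * poisson s ((z.1 : R) - z.2)).
Proof.
move=> s0 ih; under eq_Rintegral do rewrite abel_nsq_ft//.
have iG := integrable_abel_integrand s0 ih.
rewrite -(Rintegral_sigma_prod iG) (Rintegral_sigma_prod2 iG).
apply: eq_Rintegral => z _.
exact: (Rintegral_abel_cexpi ((z.1 : R) - z.2) (h z.1 * (h z.2)^*) s0).
Qed.

Lemma integral_abel_nsq_ft s h : 0 < s -> cintegrable mu h ->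
  (\int[mu]_q (abel (2 * pi * s) q * nsq (ft mu phaseR h q))%:E =
   (\int[sigma_prod mu mu]_z (Re (h z.1 * (h z.2)^*) * poisson s ((z.1 : R) - z.2)))%:E)%E.
Proof.
move=> s0 ih; rewrite -Rintegral_abel_nsq_ft// /Rintegral fineK//.
exact: (integrable_fin_num measurableT (integrable_abel_nsq_ft s0 ih)).
Qed.

Lemma measurable_poisson_diff s : 0 < s ->
  measurable_fun setT (fun z : RT * RT => poisson s ((z.1 : R) - z.2)).
Proof.
move=> s0; apply: (measurableT_comp (measurable_poisson s0)).
exact: measurable_funB.
Qed.

(* Schur's test: [|h(x) h(y)| <= (|h(x)|^2 + |h(y)|^2) / 2] and the Poisson kernel
   has mass one in each variable. *)
Lemma poisson_form_le s h : 0 < s -> cintegrable mu h -> L2 mu h ->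
  (sigma_prod mu mu).-integrable setT
    (EFin \o (fun z => Re (h z.1 * (h z.2)^*) * poisson s ((z.1 : R) - z.2))) /\
  \int[sigma_prod mu mu]_z (Re (h z.1 * (h z.2)^*) * poisson s ((z.1 : R) - z.2)) <=
    norm2 mu h.
Proof.
move=> s0 ih Lh; have mh := cintegrable_measurable ih.
have mk := measurable_poisson_diff s0; have s0' := ltW s0.
have mh1 : cmeasurable (fun z : RT * RT => h z.1).
  exact: (cmeasurable_comp mh measurable_fst).
have mh2 : cmeasurable (fun z : RT * RT => h z.2).
  exact: (cmeasurable_comp mh measurable_snd).
pose A (z : RT * RT) := nsq (h z.1) * poisson s ((z.1 : R) - z.2).
pose B (z : RT * RT) := nsq (h z.2) * poisson s ((z.1 : R) - z.2).
have mA : measurable_fun setT (EFin \o A).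
  by apply/measurable_EFinP; apply: measurable_funM => //; exact: (measurable_nsq mh1).
have mB : measurable_fun setT (EFin \o B).
  by apply/measurable_EFinP; apply: measurable_funM => //; exact: (measurable_nsq mh2).
have A0 z : 0 <= A z by rewrite mulr_ge0 ?nsq_ge0 ?poisson_ge0.
have B0 z : 0 <= B z by rewrite mulr_ge0 ?nsq_ge0 ?poisson_ge0.
have EA : (\int[sigma_prod mu mu]_z (A z)%:E = enorm2 mu h)%E.
  rewrite tonelli_sigma_prod1//; apply: eq_integral => x _.
  (* Here the integration is over the second variable; the kernel is even, so its mass is again
     one. *)
  under eq_integral do rewrite /A /= EFinM -poissonN opprB.
  rewrite ge0_integralZl//.
  - by rewrite integral_poisson_shift// mule1.
  - apply/measurable_EFinP; apply: continuous_measurable_fun; exact: continuous_poisson.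
  - by move=> y _; rewrite lee_fin poisson_ge0.
  - by rewrite lee_fin nsq_ge0.
have EB : (\int[sigma_prod mu mu]_z (B z)%:E = enorm2 mu h)%E.
  rewrite tonelli_sigma_prod2//; apply: eq_integral => y _.
  under eq_integral do rewrite /B /= EFinM.
  rewrite ge0_integralZl//.
  - by rewrite integral_poisson_shift// mule1.
  - apply/measurable_EFinP; apply: continuous_measurable_fun; exact: continuous_poisson.
  - by move=> x _; rewrite lee_fin poisson_ge0.
  - by rewrite lee_fin nsq_ge0.
have iA : (sigma_prod mu mu).-integrable setT (EFin \o A).
  apply/integrableP; split => //; under eq_integral do rewrite /= ger0_norm//.
  by rewrite EA; case: Lh.
have iB : (sigma_prod mu mu).-integrable setT (EFin \o B).
  apply/integrableP; split => //; under eq_integral do rewrite /= ger0_norm//.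
  by rewrite EB; case: Lh.
have iAB : (sigma_prod mu mu).-integrable setT (EFin \o (fun z => 2^-1 * (A z + B z))).
  exact: (integrableZl measurableT (2^-1) (integrableD measurableT iA iB)).
have RhhE z : `|Re (h z.1 * (h z.2)^*)| <= 2^-1 * (nsq (h z.1) + nsq (h z.2)).
  rewrite /nsq !reimE ler_norml.
  move: (Re (h z.1)) (Im (h z.1)) (Re (h z.2)) (Im (h z.2)) => a b c e.
  have := sqr_ge0 (a + c); have := sqr_ge0 (b + e).
  have := sqr_ge0 (a - c); have := sqr_ge0 (b - e).
  by move=> *; apply/andP; split; nra.
have key z : `|Re (h z.1 * (h z.2)^*)| * poisson s ((z.1 : R) - z.2) <=
    2^-1 * (A z + B z).
  apply: (le_trans (ler_wpM2r (poisson_ge0 _ s0') (RhhE z))).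
  by rewrite /A /B; move: (poisson _ _) => k; rewrite -mulrA mulrDl.
have iP : (sigma_prod mu mu).-integrable setT
    (EFin \o (fun z => Re (h z.1 * (h z.2)^*) * poisson s ((z.1 : R) - z.2))).
  apply: le_integrable iAB => //.
    apply/measurable_EFinP; apply: measurable_funM => //.
    by case: (cmeasurableM mh1 (cmeasurable_conj mh2)).
  move=> z _; rewrite /= lee_fin normrM (ger0_norm (poisson_ge0 _ s0')).
  by apply: (le_trans (key z)); exact: ler_norm.
split => //; apply: (le_trans (le_Rintegral measurableT iP iAB _)).
  move=> z _; apply: (le_trans (ler_norm _)).
  by rewrite normrM (ger0_norm (poisson_ge0 _ s0')) key.
rewrite RintegralZl//; last exact: (integrableD measurableT iA iB).
rewrite RintegralD// {1 2}/Rintegral EA EB enorm2E//= le_eqVlt; apply/orP; left.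
by apply/eqP; field.
Qed.

Lemma abel_nsq_ft_le s h : 0 < s -> cintegrable mu h -> L2 mu h ->
  (\int[mu]_q (abel (2 * pi * s) q * nsq (ft mu phaseR h q))%:E <= enorm2 mu h)%E.
Proof.
move=> s0 ih Lh; rewrite integral_abel_nsq_ft// (enorm2E Lh) lee_fin.
by have [] := poisson_form_le s0 ih Lh.
Qed.

(** As s = 1/(n+1) decreases to 0 the weights increase to 1, so monotone convergence passes the
    uniform bound to the limit and yields the finiteness of the left side as well. *)
Lemma bessel h : cintegrable mu h -> L2 mu h ->
  (enorm2 mu (ft mu phaseR h) <= enorm2 mu h)%E.
Proof.
move=> ih Lh.
pose s n : R := n.+1%:R^-1.
have s0 n : 0 < s n by rewrite invr_gt0.
pose w n q := (abel (2 * pi * s n) q * nsq (ft mu phaseR h q))%:E.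
have mft := cmeasurable_ft mu measurable_phaseR (cintegrable_measurable ih).
have mw n : measurable_fun setT (w n).
  apply/measurable_EFinP; apply: measurable_funM; last exact: measurable_nsq mft.
  exact: measurable_abel.
have w0 n q : (0 <= w n q)%E by rewrite lee_fin mulr_ge0 ?abel_ge0 ?nsq_ge0.
have ndw q : nondecreasing_seq (w ^~ q).
  move=> m n mn; rewrite lee_fin ler_wpM2r ?nsq_ge0// /abel ler_expR lerN2.
  rewrite !ler_wpM2r//; rewrite ler_wpM2l ?mulr_ge0 ?pi_ge0//.
  by rewrite lef_pV2 ?posrE// ler_nat.
have wlim q : limn (w ^~ q) = (nsq (ft mu phaseR h q))%:E.
  have c0 : - (2 * pi * s n * `|q|) @[n --> \oo] --> (0 : R).
    rewrite -[X in _ --> X]oppr0; apply: cvgN.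
    rewrite -[X in _ --> X](mul0r `|q|); apply: cvgM; last exact: cvg_cst.
    rewrite -[X in _ --> X](mulr0 (2 * pi)); apply: cvgM; first exact: cvg_cst.
    exact: cvg_harmonic.
  have c1 : abel (2 * pi * s n) q @[n --> \oo] --> (1 : R).
    have := continuous_cvg _ (@continuous_expR R 0) c0; rewrite expR0; exact.
  apply/cvg_lim => //; apply: cvg_EFin; first exact: nearW.
  by rewrite -[X in _ --> X]mul1r; apply: (cvgM c1); exact: cvg_cst.
rewrite {1}/enorm2; under eq_integral do rewrite -wlim.
rewrite monotone_convergence//.
apply: lime_le.
  apply: ereal_nondecreasing_is_cvgn => m n mn; apply: ge0_le_integral => //.
  - exact: mw.
  - exact: mw.
  - by move=> q _; exact: ndw.
by apply: nearW => n; exact: abel_nsq_ft_le.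
Qed.

End abel_means.

(** * Equality for indicators of intervals *)

Section interval_plancherel.
Context {R : realType}.
Local Notation mu := (@lebesgue_measure R).
Local Notation RT := (measurableTypeR R).

Definition cindic (A : set RT) (x : RT) : R[i] := (\1_A x : R)%:C.

Lemma nsq_cindic A x : nsq (cindic A x) = \1_A x.
Proof. by rewrite nsq_real indicE; case: (_ \in _); rewrite ?expr1n ?expr0n. Qed.

Lemma cmeasurable_cindic A : measurable A -> cmeasurable (cindic A).
Proof. by move=> mA; split => //=; exact: measurable_indic. Qed.

Lemma enorm2_cindic A : measurable A -> enorm2 mu (cindic A) = mu A.
Proof.
move=> mA; rewrite /enorm2; under eq_integral do rewrite nsq_cindic.
by rewrite integral_indic// setIT.
Qed.

Lemma integrable_indicT (A : set RT) : measurable A -> (mu A < +oo)%E ->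
  mu.-integrable setT (EFin \o (\1_A : RT -> R)).
Proof.
move=> mA Aoo; apply/integrableP; split.
  by apply/measurable_EFinP; exact: measurable_indic.
under eq_integral do rewrite /= ger0_norm//.
by rewrite integral_indic// setIT.
Qed.

Lemma cintegrable_cindic A : measurable A -> (mu A < +oo)%E ->
  cintegrable mu (cindic A).
Proof.
move=> mA Aoo; split; last exact: integrable0.
exact: integrable_indicT.
Qed.

Lemma L2_cindic A : measurable A -> (mu A < +oo)%E -> L2 mu (cindic A).
Proof.
by move=> mA Aoo; split; [exact: cmeasurable_cindic|rewrite enorm2_cindic].
Qed.

(** The Poisson integral of the indicator of []a, b]]: for [a < b] and [s > 0], the angle under
    which the interval is seen from the point (y, s) of the upper half-plane, divided by pi. *)
Definition poisson_itv (a b s y : R) : R :=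
  (atan ((b - y) / s) - atan ((a - y) / s)) / pi.

(** For an indicator the integrand of the Poisson form is nonnegative, so Tonelli applies and the
    primitive of the kernel gives the inner integral. *)
Lemma poisson_form_itv (a b s : R) : 0 < s -> a < b ->
  (\int[mu]_q (abel (2 * pi * s) q *
      nsq (ft mu phaseR (cindic `]a, b]%classic) q))%:E =
   \int[mu]_y (\1_(`]a, b]%classic) y * poisson_itv a b s y)%:E)%E.
Proof.
move=> s0 ab; set A := `]a, b]%classic.
have mA : measurable (A : set RT) by exact: measurable_itv.
have Aoo : (mu A < +oo)%E.
  by rewrite /A lebesgue_measure_itv/= lte_fin ab -EFinB ltry.
have ih := cintegrable_cindic mA Aoo; have Lh := L2_cindic mA Aoo.
rewrite integral_abel_nsq_ft//.
have [iP _] := poisson_form_le s0 ih Lh.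
rewrite /Rintegral fineK; last exact: (integrable_fin_num measurableT iP).
have F0 (z : RT * RT) : (0 <= (Re (cindic A z.1 * (cindic A z.2)^*) *
    poisson s ((z.1 : R) - z.2))%:E)%E.
  rewrite lee_fin mulr_ge0 ?poisson_ge0 ?(ltW s0)// !reimE /= mul0r subr0.
  by rewrite mulr_ge0.
have [mF _] := integrableP _ _ _ iP.
rewrite tonelli_sigma_prod2//; apply: eq_integral => y _.
have -> : (\int[mu]_x (Re (cindic A x * (cindic A y)^*) * poisson s (x - y))%:E =
    \int[mu]_x ((\1_A y)%:E * ((fun x => (poisson s (x - y))%:E) \_ A) x))%E.
  apply: eq_integral => x _; rewrite !reimE /= mul0r subr0 patchE.
  rewrite [X in (X * _ * _)%:E]indicE; case: ifPn => xA.
    by rewrite mul1r EFinM.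
  by rewrite !mul0r mule0.
rewrite ge0_integralZl//.
- rewrite -integral_mkcond integral_poisson_itv// EFinM; congr (_ * _)%E.
- apply/(measurable_restrictT _ mA).
  apply/measurable_EFinP; apply: measurable_funTS.
  by apply: continuous_measurable_fun; exact: continuous_poisson.
- move=> x _; rewrite patchE; case: ifP => // _.
  by rewrite lee_fin poisson_ge0// ltW.
Qed.

Lemma cvg_atan_scale (c : R) : 0 < c ->
  atan (c / n.+1%:R^-1) @[n --> \oo] --> (pi / 2 : R).
Proof.
move=> c0.
have cy : c / n.+1%:R^-1 @[n --> \oo] --> +oo.
  apply/cvgryPge => M; near=> n; rewrite invrK -ler_pdivrMl// mulrC.
  rewrite (@le_trans _ _ n%:R)// ?ler_nat//.
  by near: n; exact: nbhs_infty_ger.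
exact: (cvg_comp _ _ cy (@cvgy_atan R)).
Unshelve. all: by end_near. Qed.

Lemma cvg_poisson_itv (a b y : R) : a < y < b ->
  poisson_itv a b n.+1%:R^-1 y @[n --> \oo] --> (1 : R).
Proof.
move=> /andP[ay yb].
have c1 : atan ((b - y) / n.+1%:R^-1) @[n --> \oo] --> (pi / 2 : R).
  by apply: cvg_atan_scale; rewrite subr_gt0.
have c2 : atan ((y - a) / n.+1%:R^-1) @[n --> \oo] --> (pi / 2 : R).
  by apply: cvg_atan_scale; rewrite subr_gt0.
have one : (pi / 2 + pi / 2) * pi^-1 = 1 :> R.
  by move: (@pi R) (pi_gt0 R) => p p0; field; rewrite gt_eqF.
rewrite -[X in _ --> X]one.
rewrite [X in X @ _](_ : _ = fun n : nat =>
    (atan ((b - y) / n.+1%:R^-1) + atan ((y - a) / n.+1%:R^-1)) * pi^-1); last first.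
  apply/funext => n; rewrite /poisson_itv.
  by rewrite -[(y - a) / _]opprK -mulNr opprB atanN.
by apply: cvgM; [exact: cvgD|exact: cvg_cst].
Qed.

Lemma poisson_itv_bound (a b s y : R) : 0 < s -> a < b ->
  `|poisson_itv a b s y| <= 1.
Proof.
move=> s0 ab; rewrite /poisson_itv normrM (@ger0_norm _ pi^-1) ?invr_ge0 ?pi_ge0//.
rewrite ler_pdivrMr ?pi_gt0// mul1r.
have h1 := atan_gtNpi2 ((b - y) / s); have h2 := atan_ltpi2 ((b - y) / s).
have h3 := atan_gtNpi2 ((a - y) / s); have h4 := atan_ltpi2 ((a - y) / s).
move: (atan _) (atan _) h1 h2 h3 h4 => u v h1 h2 h3 h4.
by rewrite ler_norml; apply/andP; split; lra.
Qed.

(** Only the lower bound remains after [bessel]. The weights are at most 1, so each Abel mean is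
    below the norm of the transform, and by dominated convergence the means tend to the length of
    the interval. *)
Lemma plancherel_itv (a b : R) : a < b ->
  enorm2 mu (ft mu phaseR (cindic `]a, b]%classic)) =
  enorm2 mu (cindic `]a, b]%classic).
Proof.
move=> ab; set A := `]a, b]%classic.
have mA : measurable (A : set RT) by exact: measurable_itv.
have Aoo : (mu A < +oo)%E.
  by rewrite /A lebesgue_measure_itv/= lte_fin ab -EFinB ltry.
have ih := cintegrable_cindic mA Aoo; have Lh := L2_cindic mA Aoo.
apply/eqP; rewrite eq_le bessel//=.
pose s n : R := n.+1%:R^-1; have s0 n : 0 < s n by rewrite invr_gt0.
pose f n (y : RT) := (\1_A y * poisson_itv a b (s n) y)%:E.
have mft := cmeasurable_ft mu measurable_phaseR (cintegrable_measurable ih).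
have fle n : (\int[mu]_y f n y <= enorm2 mu (ft mu phaseR (cindic A)))%E.
  rewrite -poisson_form_itv//; apply: ge0_le_integral => //.
  - by move=> q _; rewrite lee_fin mulr_ge0 ?abel_ge0 ?nsq_ge0.
  - apply/measurable_EFinP; apply: measurable_funM; last exact: measurable_nsq mft.
    exact: measurable_abel.
  - exact: measurable_EFin_nsq mft.
  - move=> q _; rewrite lee_fin ler_piMl ?nsq_ge0// /abel -expR0 ler_expR oppr_le0.
    by rewrite !mulr_ge0 ?pi_ge0 ?(ltW (s0 n)).
have [] := @dominated_convergence _ RT R mu setT measurableT f
  (fun y => (\1_A y)%:E) (fun y => (\1_A y)%:E).
- move=> n; apply/measurable_EFinP; apply: measurable_funM; first exact: measurable_indic.
  have cp : continuous (poisson_itv a b (s n)).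
    move=> y; apply: cvgM; last exact: cvg_cst.
    have c (c : R) : {for y, continuous (fun y => atan ((c - y) / s n))}.
      apply/differentiable_continuous/derivable1_diffP; exact: ex_derive.
    by apply: cvgB; exact: c.
  exact: continuous_measurable_fun.
- by apply/measurable_EFinP; exact: measurable_indic.
(* At the right end, which belongs to the interval, [poisson_itv] tends to 1/2 and not to 1; this
   single point is discarded as a null set. *)
- exists [set b]; split => //; first exact: lebesgue_measure_set1.
  move=> y /=; apply: contra_notP => /eqP yb _.
  apply: cvg_EFin; first exact: nearW.
  have [yA|yA] := boolP (y \in A).
    rewrite [X in _ --> X](_ : _ = 1 * 1); last by rewrite indicE yA mul1r.
    apply: cvgM; first by rewrite indicE yA; exact: cvg_cst.
    apply: cvg_poisson_itv; move: yA; rewrite inE /A/= in_itv/= => /andP[-> yb'].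
    by rewrite lt_neqAle yb yb'.
  rewrite [X in X @ _](_ : _ = (fun=> 0)); last first.
    by apply/funext => n; rewrite /= indicE (negbTE yA) mul0r.
  by rewrite indicE (negbTE yA); exact: cvg_cst.
- exact: integrable_indicT.
- apply: aeW => y n _; rewrite /f /= lee_fin normrM.
  rewrite [X in X * _]ger0_norm// ler_piMr//.
  exact: poisson_itv_bound.
move=> _ _ flim; rewrite enorm2_cindic//.
have <- : (\int[mu]_y (\1_A y)%:E = mu A)%E by rewrite integral_indic// setIT.
have /cvg_lim <- // := flim.
apply: lime_le; first by apply/cvg_ex; eexists; exact: flim.
by apply: nearW => n; exact: fle.
Qed.

End interval_plancherel.

(** * The functions for which Bessel's inequality is an equality *)

Section plancherel_defect.
Context d (T : measurableType d) (R : realType).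
Variable mu : {sigma_finite_measure set T -> \bar R}.
Variable phi : T -> T -> R.
Hypothesis mphi : measurable_fun setT (fun z : T * T => phi z.1 z.2).
Hypothesis bessel_phi : forall h, cintegrable mu h -> L2 mu h ->
  (enorm2 mu (ft mu phi h) <= enorm2 mu h)%E.
Implicit Types f h u : T -> R[i].

Definition L12 h : Prop := cintegrable mu h /\ L2 mu h.

Definition defect h : R := norm2 mu h - norm2 mu (ft mu phi h).

Lemma L12D f h : L12 f -> L12 h -> L12 (fun x => f x + h x).
Proof. by move=> [i1 l1] [i2 l2]; split; [exact: cintegrableD|exact: L2D]. Qed.

Lemma L12Z (a : R[i]) h : L12 h -> L12 (fun x => a * h x).
Proof. by move=> [i1 l1]; split; [exact: cintegrableZ|exact: L2Z]. Qed.

Lemma subZE f h : (fun x => f x - h x) = (fun x => f x + -1 * h x).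
Proof. by apply/funext => x; rewrite mulN1r. Qed.

Lemma L12B f h : L12 f -> L12 h -> L12 (fun x => f x - h x).
Proof. by move=> Df /(L12Z (-1)) Dh; rewrite subZE; exact: L12D. Qed.

Lemma L2_ft h : L12 h -> L2 mu (ft mu phi h).
Proof.
move=> [ih Lh]; split; first exact: (cmeasurable_ft _ mphi (cintegrable_measurable ih)).
by apply: le_lt_trans (bessel_phi ih Lh) _; case: Lh.
Qed.

Lemma ftB f h : cintegrable mu f -> cintegrable mu h ->
  ft mu phi (fun x => f x - h x) = (fun q => ft mu phi f q - ft mu phi h q).
Proof.
move=> i1 i2; rewrite subZE ftD//; last exact: cintegrableZ.
by rewrite ftZ// subZE.
Qed.

Lemma defect_ge0 h : L12 h -> 0 <= defect h.
Proof.
move=> Dh; have := bessel_phi Dh.1 Dh.2.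
by rewrite (enorm2E (L2_ft Dh)) (enorm2E Dh.2) lee_fin subr_ge0.
Qed.

Lemma defect_le h : defect h <= norm2 mu h.
Proof. by rewrite gerBl norm2_ge0. Qed.

(** The parallelogram identity holds for both norms, hence for their difference: the defects of
    [f + h] and [f - h] add up to the right side, and the latter is nonnegative. *)
Lemma defectD f h : L12 f -> L12 h ->
  defect (fun x => f x + h x) <= 2 * defect f + 2 * defect h.
Proof.
move=> Df Dh; have := defect_ge0 (L12B Df Dh); rewrite /defect.
have := norm2_parallelogram Df.2 Dh.2.
have := norm2_parallelogram (L2_ft Df) (L2_ft Dh).
have [if_ _] := Df; have [ih _] := Dh; rewrite (ftB if_ ih) (ftD mphi if_ ih).
do 8 move: (norm2 mu _) => ?; lra.
Qed.

Lemma defectZ (a : R[i]) h : L12 h -> defect (fun x => a * h x) = nsq a * defect h.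
Proof.
move=> Dh; rewrite /defect ftZ//; last by case: Dh.
by rewrite !norm2Z ?mulrBr//; [exact: L2_ft|case: Dh].
Qed.

Definition isometric h : Prop := L12 h /\ defect h = 0.

Lemma isometric_enorm2 h : isometric h -> enorm2 mu (ft mu phi h) = enorm2 mu h.
Proof.
move=> [Dh /eqP]; rewrite subr_eq0 => /eqP E.
by rewrite (enorm2E (L2_ft Dh)) (enorm2E Dh.2) E.
Qed.

Lemma isometricP h : L12 h -> enorm2 mu (ft mu phi h) = enorm2 mu h -> isometric h.
Proof.
move=> Dh; rewrite (enorm2E (L2_ft Dh)) (enorm2E Dh.2) => -[E].
by split; [exact: Dh|rewrite /defect E subrr].
Qed.

Lemma isometricD f h : isometric f -> isometric h -> isometric (fun x => f x + h x).
Proof.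
move=> [Df f0] [Dh h0]; have Dfh := L12D Df Dh; split; first exact: Dfh.
apply/eqP; rewrite eq_le defect_ge0// andbT.
by have := defectD Df Dh; rewrite f0 h0 !mulr0 addr0.
Qed.

Lemma isometricZ (a : R[i]) h : isometric h -> isometric (fun x => a * h x).
Proof. by move=> [Dh h0]; split; [exact: L12Z|rewrite defectZ// h0 mulr0]. Qed.

Lemma isometricB f h : isometric f -> isometric h -> isometric (fun x => f x - h x).
Proof. by move=> If /(isometricZ (-1)) Ih; rewrite subZE; exact: isometricD. Qed.

(** For an isometric [u], [defectD] and [defect_le] bound [defect h] by twice the squared distance
    from [h] to [u]; hence the tolerance [e / 2]. *)
Lemma isometric_closed h : L12 h ->
  (forall e : R, 0 < e -> exists2 u, isometric u & norm2 mu (fun x => h x - u x) < e) ->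
  isometric h.
Proof.
move=> Dh clo; split; first exact: Dh.
apply/eqP; rewrite eq_le defect_ge0// andbT.
apply/ler_addgt0Pl => e e0; rewrite addr0.
have [|u [Du u0] hu] := clo (e / 2); first by rewrite divr_gt0.
have Dhu := L12B Dh Du.
have := defectD Dhu Du; rewrite u0 mulr0 addr0.
have -> : (fun x => h x - u x + u x) = h by apply/funext => x; rewrite subrK.
move=> /le_trans; apply; have := defect_le (fun x => h x - u x).
by move: hu; move: (norm2 mu _) (defect _) => ? ?; lra.
Qed.

Lemma isometric0 h : isometric h -> isometric (fun=> 0).
Proof.
by move=> /(isometricZ 0); under eq_fun do rewrite mul0r.
Qed.

Lemma isometric_sum (I : Type) (s : seq I) (F : I -> T -> R[i]) h : isometric h ->
  (forall i, isometric (F i)) -> isometric (fun x => \sum_(i <- s) F i x).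
Proof.
move=> Ih IF; elim: s => [|i s IHs].
  by under eq_fun do rewrite big_nil; exact: isometric0 Ih.
under eq_fun do rewrite big_cons.
exact: (isometricD (IF i) IHs).
Qed.

End plancherel_defect.

(** * From intervals to all integrable and square integrable functions *)

Section plancherel_lebesgue.
Context {R : realType}.
Local Notation mu := (@lebesgue_measure R).
Local Notation RT := (measurableTypeR R).
Local Notation isom := (isometric mu (@phaseR R)).

Import HBNNSimple.

(** Complements, which occur in Dynkin's induction, leave L^1 and L^2 unless everything is cut to a
    set of finite measure. The windows are half-open to belong to the generating class [ocitv], and
    [n.+1] keeps them nonempty for [n = 0]. *)
Let window (n : nat) : set RT := `]- n.+1%:R, n.+1%:R]%classic.

Let measurable_window n : measurable (window n).
Proof. exact: measurable_itv. Qed.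

Let window_lt n : - n.+1%:R < n.+1%:R :> R.
Proof. by rewrite (@lt_trans _ _ 0)// oppr_lt0. Qed.

Let window_lty n : (mu (window n) < +oo)%E.
Proof.
by rewrite /window lebesgue_measure_itv/= lte_fin window_lt -EFinB ltry.
Qed.

Let L12_cindic A : measurable A -> (mu A < +oo)%E -> L12 mu (cindic A).
Proof. by move=> mA Aoo; split; [exact: cintegrable_cindic|exact: L2_cindic]. Qed.

Lemma isometric_itv (a b : R) : a < b -> isom (cindic `]a, b]%classic).
Proof.
move=> ab; apply: (isometricP measurable_phaseR bessel); last exact: plancherel_itv.
apply: L12_cindic; first exact: measurable_itv.
by rewrite lebesgue_measure_itv/= lte_fin ab -EFinB ltry.
Qed.

Lemma isometric_cst0 : isom (fun=> 0).
Proof. exact: (isometric0 measurable_phaseR bessel (isometric_itv ltr01)). Qed.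

Lemma cindic_set0 : cindic (set0 : set RT) = fun=> 0.
Proof. by apply/funext => x; rewrite /cindic indic0. Qed.

(** Dynkin's theorem for the half-open intervals, which are closed under intersection. A complement
    within the window is a difference of indicators; a disjoint countable union is an L^2 limit of
    finite ones, because the measure of the remainder tends to 0. *)
Lemma isometric_window_cap n (A : set RT) : measurable A -> isom (cindic (A `&` window n)).
Proof.
have mI S : measurable S -> measurable (S `&` window n) by move=> mS; exact: measurableI.
have Ioo (S : set RT) : measurable S -> (mu (S `&` window n) < +oo)%E.
  move=> mS; apply: le_lt_trans (window_lty n).
  by apply: le_measure; rewrite ?inE//; exact: mI.
apply: (@dynkin_induction _ RT (@ocitv R) [set S | isom (cindic (S `&` window n))]).
- by [].
- exact: ocitvI.
- by rewrite /= setTI; exact: isometric_itv.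
- move=> S oS; have : ocitv (S `&` window n) by apply: ocitvI => //; exact: is_ocitv.
  move=> /ocitvP [S0|[[a b] /= ab SE]] /=.
    by rewrite S0 cindic_set0; exact: isometric_cst0.
  by rewrite SE; exact: isometric_itv.
- move=> S mS IS /=.
  have -> : cindic (~` S `&` window n) =
      fun x => cindic (window n) x - cindic (S `&` window n) x.
    apply/funext => x; rewrite /cindic -rmorphB/=; congr (_%:C).
    rewrite !indicE !in_setI in_setC.
    by case: (x \in S); case: (x \in window n); rewrite /= ?subrr ?subr0.
  exact: (isometricB measurable_phaseR bessel (isometric_itv (window_lt n)) IS).
- move=> F mF tF IF /=.
  set U := \bigcup_k F k `&` window n.
  pose V k := (\big[setU/set0]_(i < k) F i) `&` window n.
  have mU : measurable U by apply: mI; exact: bigcup_measurable.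
  have mV k : measurable (V k) by apply: mI; exact: bigsetU_measurable.
  have VS k : V k.+1 = V k `|` (F k `&` window n) by rewrite /V big_ord_recr/= setIUl.
  have IV k : isom (cindic (V k)).
    elim: k => [|k IHk].
      by rewrite /V big_ord0 set0I cindic_set0; exact: isometric_cst0.
    have -> : cindic (V k.+1) = fun x => cindic (V k) x + cindic (F k `&` window n) x.
      apply/funext => x; rewrite /cindic -rmorphD/=; congr (_%:C).
      rewrite VS !indicE in_setU.
      have [xV|xV] := boolP (x \in V k); have [xF|xF] := boolP (x \in F k `&` window n);
        rewrite /= ?addr0 ?add0r//; exfalso.
      (* A point of both sets would lie in [F k] and in some [F i] with [i < k], against
         disjointness. *)
      move: xV xF; rewrite !inE => -[+ _] [Fkx _].
      rewrite -bigcup_mkord => -[i /= ik Fix].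
      have /trivIsetP/(_ i k I I) := tF; rewrite ltn_eqF// => /(_ isT).
      by move=> /seteqP[+ _] => /(_ x); apply.
    exact: (isometricD measurable_phaseR bessel IHk (IF k)).
  have VU k : V k `<=` U.
    by move=> x [+ wx]; rewrite -bigcup_mkord => -[i _ Fix]; split => //; exists i.
  have UV : U = \bigcup_k V k.
    apply/seteqP; split => x; last by move=> [k _ /VU].
    move=> [[k _ Fkx] wx]; exists k.+1 => //; split => //.
    by rewrite -bigcup_mkord; exists k => /=.
  have Uoo : (mu U < +oo)%E by apply: Ioo; exact: bigcup_measurable.
  have cvV : mu (V k) @[k --> \oo] --> mu U.
    rewrite UV; apply: nondecreasing_cvg_mu => //; first by rewrite -UV.
    by apply/nondecreasing_seqP => k; rewrite VS; apply/subsetPset; exact: subsetUl.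
  apply: (isometric_closed measurable_phaseR bessel); first exact: L12_cindic.
  move=> e e0.
  have Ufin : mu U \is a fin_num by rewrite ge0_fin_numE.
  have Vfin k : mu (V k) \is a fin_num.
    rewrite ge0_fin_numE//; apply: le_lt_trans Uoo.
    by apply: le_measure; rewrite ?inE//; exact: VU.
  have [k Vk] : exists k, (mu U - mu (V k) < e%:E)%E.
    move: cvV; rewrite -(fineK Ufin) => /fine_cvgP[_ /cvgrPdist_lt /(_ e e0)].
    move=> [k _ /(_ k (leqnn k)) /= Vk]; exists k.
    rewrite -(fineK (Vfin k)) -EFinB lte_fin.
    exact: le_lt_trans (ler_norm _) Vk.
  exists (cindic (V k)); first exact: IV.
  (* The squared distance of the two indicators is the measure of the set difference, which is
     [mu U - mu (V k)]. *)
  have -> : (fun x => cindic U x - cindic (V k) x) = cindic (U `\` V k).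
    apply/funext => x; rewrite /cindic -rmorphB/=; congr (_%:C).
    rewrite !indicE in_setD.
    have := VU k x; case: (boolP (x \in V k)) => [/set_mem xV /(_ xV)/mem_set ->|_ _].
      by rewrite andbF subrr.
    by rewrite andbT subr0.
  have mUV : measurable (U `\` V k) by exact: measurableD.
  rewrite -lte_fin -enorm2E; last first.
    apply: L2_cindic => //; apply: le_lt_trans Uoo.
    by apply: le_measure; rewrite ?inE// => x [].
  by rewrite enorm2_cindic// measureD// setIidr//; exact: VU.
Qed.

Let isometric_simple n (f : {nnsfun RT >-> R}) :
  isom (fun x => (f x * \1_(window n) x)%:C).
Proof.
have -> : (fun x => (f x * \1_(window n) x)%:C) =
    (fun x => \sum_(y <- fset_set (range f))
      (y%:C * cindic (f @^-1` [set y] `&` window n) x)).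
  apply/funext => x; rewrite [f x]fimfunE fsbig_finite//= mulr_suml rmorph_sum/=.
  apply: eq_bigr => y _; rewrite /cindic -rmorphM/=; congr (_%:C).
  by rewrite indicI mulrA.
apply: (isometric_sum measurable_phaseR bessel _ isometric_cst0) => y.
apply: (isometricZ measurable_phaseR bessel).
by apply: isometric_window_cap; exact: measurable_sfunP.
Qed.

(** Simple functions cut to growing windows converge to [f] from below, and the squared error is
    dominated by [f^2]; they therefore converge in L^2, and the closedness of the isometric
    functions concludes. *)
Let isometric_ge0 (f : RT -> R) : (forall x, 0 <= f x) ->
  L12 mu (fun x => (f x)%:C) -> isom (fun x => (f x)%:C).
Proof.
move=> f0 Df.
have mf : measurable_fun setT f by case: Df => _ [[]].
have mEf : measurable_fun setT (EFin \o f) by exact/measurable_EFinP.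
pose g n : {nnsfun RT >-> R} := nnsfun_approx measurableT mEf n.
have gf n x : g n x <= f x.
  have := @le_approx _ _ _ setT (EFin \o f) n x.
  by rewrite -lee_fin nnsfun_approxE; apply => // y _; rewrite lee_fin.
have gcvg x : g n x @[n --> \oo] --> f x.
  have := @cvg_nnsfun_approx _ _ _ setT measurableT (EFin \o f) mEf _ x I.
  by move=> /(_ _) /fine_cvgP[]//= y _; rewrite lee_fin.
pose u n x := g n x * \1_(window n) x.
have u0 n x : 0 <= u n x by rewrite mulr_ge0.
have uf n x : u n x <= f x.
  by apply: le_trans (gf n x); rewrite ler_piMr// indicE; case: (_ \in _).
have ucvg x : u n x @[n --> \oo] --> f x.
  rewrite -[X in _ --> X]mulr1; apply: cvgM => //.
  apply: cvg_near_cst; near=> n; rewrite indicE mem_set//= /window/= in_itv/=.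
  have : `|x| <= n%:R by near: n; exact: nbhs_infty_ger.
  rewrite ler_norml => /andP[nx xn].
  (* The window is open on the left; its end [- n.+1] lies strictly below [- n]. *)
  rewrite (lt_le_trans _ nx) ?ltrN2 ?ltr_nat//= (le_trans xn)// ler_nat.
  exact: leqnSn.
have mu_ n : measurable_fun setT (u n).
  by apply: measurable_funM => //; exact: measurable_indic.
apply: (isometric_closed measurable_phaseR bessel) => // e e0.
have [] := @dominated_convergence _ RT R mu setT measurableT
  (fun n x => ((f x - u n x) ^+ 2)%:E) (fun=> 0%E) (fun x => (nsq ((f x)%:C))%:E).
- by move=> n; apply/measurable_EFinP; apply: measurable_funX; exact: measurable_funB.
- exact: measurable_cst.
- apply: aeW => x _; apply: cvg_EFin; first exact: nearW.
  have c0 : f x - u n x @[n --> \oo] --> (0 : R).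
    by rewrite -[X in _ --> X](subrr (f x)); apply: cvgB => //; exact: cvg_cst.
  by rewrite -[X in _ --> X](mulr0 0); exact: cvgM.
- exact: integrable_nsq Df.2.
- apply: aeW => x n _; rewrite /= lee_fin nsq_real ger0_norm ?sqr_ge0//.
  by rewrite lerXn2r ?nnegrE ?subr_ge0// gerBl.
rewrite integral0 => _ _ /fine_cvgP[_ /cvgrPdist_lt /(_ e e0)].
move=> [n _ /(_ n (leqnn n)) /= ne].
exists (fun x => (u n x)%:C); first exact: isometric_simple.
rewrite /norm2 /Rintegral; under eq_integral do rewrite -rmorphB/= nsq_real.
by apply: le_lt_trans ne; rewrite sub0r normrN ler_norm.
Unshelve. all: by end_near. Qed.

(** Positive and negative parts of the real and imaginary parts are all bounded by the modulus of
    [h], so they stay integrable and square integrable, and isometric functions form a linear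
    space. *)
Lemma plancherel_lebesgue : plancherel mu (@phaseR R).
Proof.
move=> h ih Lh; apply: (isometric_enorm2 measurable_phaseR bessel).
have [mR mI] := cintegrable_measurable ih.
have key (u : RT -> R) : measurable_fun setT u -> (forall x, 0 <= u x) ->
    (forall x, u x <= cabs (h x)) -> isom (fun x => (u x)%:C).
  move=> mu_ u0 uh; have mc : cmeasurable (fun x => (u x)%:C) by split => //=.
  have cu x : cabs (u x)%:C = u x by rewrite cabsE nsq_real sqrtr_sqr ger0_norm.
  apply: isometric_ge0 => //; split.
    by apply: (le_cintegrable mc (cintegrable_cabs ih)) => x; rewrite cu /= uh.
  apply: (le_L2 mc (integrable_nsq Lh)) => x /=; rewrite nsq_real -sqr_cabs.
  by rewrite lerXn2r ?nnegrE ?cabs_ge0.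
have pos (v : RT -> R) : measurable_fun setT v -> (forall x, `|v x| <= cabs (h x)) ->
    isom (fun x => (v x)%:C).
  move=> mv vh.
  have -> : (fun x => (v x)%:C) =
      (fun x => (Num.max (v x) 0)%:C - (Num.max (- v x) 0)%:C).
    apply/funext => x; rewrite -rmorphB/=; congr (_%:C).
    by have [v0|v0] := leP (v x) 0; rewrite maxElt ?oppr_lt0 ?oppr_gt0; case: ifPn; lra.
  apply: (isometricB measurable_phaseR bessel); apply: key.
  - by apply: measurable_maxr.
  - by move=> x; rewrite le_max lexx orbT.
  - by move=> x; rewrite ge_max cabs_ge0 andbT (le_trans _ (vh x))// ler_norm.
  - by apply: measurable_maxr => //; exact: measurable_funN.
  - by move=> x; rewrite le_max lexx orbT.
  - by move=> x; rewrite ge_max cabs_ge0 andbT (le_trans _ (vh x))// -normrN ler_norm.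
rewrite (_ : h = (fun x => (Re (h x))%:C + 'i%C * (Im (h x))%:C)); last first.
  by apply/funext => x; exact: complexE.
apply: (isometricD measurable_phaseR bessel).
  by apply: pos => // x; exact: normr_Re_le.
apply: (isometricZ measurable_phaseR bessel).
by apply: pos => // x; exact: normr_Im_le.
Qed.

End plancherel_lebesgue.

(** * The Heisenberg group *)

Section plancherel_heisenberg.
Context {R : realType}.

Definition phase_Rn n (q x : Rn R n) : R := 2 * pi * vdot q x.

Lemma measurable_vdot n : measurable_fun setT (fun z : Rn R n * Rn R n => vdot z.1 z.2).
Proof.
apply: measurable_sum => i; apply: measurable_funM.
  exact: (measurableT_comp (measurable_tnth i) measurable_fst).
exact: (measurableT_comp (measurable_tnth i) measurable_snd).
Qed.

Lemma measurable_phase_Rn n :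
  measurable_fun setT (fun z : Rn R n * Rn R n => phase_Rn z.1 z.2).
Proof. by apply: measurable_funM => //; exact: measurable_vdot. Qed.

Lemma vdot_tuple_cons n (q x : measurableTypeR R * Rn R n) :
  vdot (tuple_cons q) (tuple_cons x) = (q.1 : R) * (x.1 : R) + vdot q.2 x.2.
Proof.
rewrite /vdot big_ord_recl !tnth0; congr (_ + _).
by apply: eq_bigr => i _; rewrite !tnthS.
Qed.

Lemma plancherel_Rn n : plancherel (lebesgueRn R n) (@phase_Rn n).
Proof.
elim: n => [|n IHn].
  move=> h ih [mh _].
  rewrite /= /enorm2 !integral_dirac//; last 2 first.
  - exact: measurable_EFin_nsq.
  - exact/measurable_EFin_nsq/(cmeasurable_ft _ (@measurable_phase_Rn 0)).
  rewrite diracT !mul1e; congr (_%:E); congr nsq.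
  (* R^0 is a point with a unit mass and its phase is an empty sum, so the transform is the
     identity. *)
  have e1 x : h x * cexpi (- phase_Rn [tuple] x) = h x.
    rewrite /phase_Rn /vdot big_ord0 mulr0 oppr0 /cexpi cos0 sin0.
    by rewrite -[X in _ * X]/(1 : R[i]) mulr1.
  rewrite /ft (eq_cint _ e1); apply: complexP; rewrite /= /Rintegral integral_dirac//;
    rewrite ?diracT ?mul1e//; apply/measurable_EFinP; by case: mh.
(* [lebesgueRn R n.+1] is by definition the image of the product measure under [tuple_cons], hence
   [erefl]. *)
apply: (@plancherel_pushforward _ _ _ _ _ (sigma_prod lebesgue_measure (lebesgueRn R n))
  (lebesgueRn R n.+1) (@tuple_cons R n) (@measurable_tuple_cons R n) erefl
  (phase_sum phaseR (@phase_Rn n))).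
- exact: measurable_phase_Rn.
- by move=> q x; rewrite /phase_Rn vdot_tuple_cons mulrDr.
- apply: plancherel_sigma_prod => //.
  + exact: measurable_phaseR.
  + exact: measurable_phase_Rn.
  + exact: plancherel_lebesgue.
Qed.

Variable n : nat.
Local Notation H := (heis R n).

Definition phaseH (q x : H) : R := 2 * pi * hdot q x.

(** The phase involves the Euclidean product and not the group law, so Plancherel's identity on H^n
    is that of the product R^n * R^n * R. *)
Lemma phaseHE : phaseH = phase_sum (phase_sum (@phase_Rn n) (@phase_Rn n)) phaseR.
Proof.
apply/funext => -[[p q] t]; apply/funext => -[[p' q'] t'].
by rewrite /phaseH /phase_sum /phase_Rn /phaseR /= !mulrDr.
Qed.

Lemma measurable_phaseH : measurable_fun setT (fun z : H * H => phaseH z.1 z.2).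
Proof.
rewrite phaseHE; apply: measurable_phase_sum; last exact: measurable_phaseR.
by apply: measurable_phase_sum; exact: measurable_phase_Rn.
Qed.

Lemma plancherel_haar : plancherel (haar R n) phaseH.
Proof.
rewrite phaseHE; apply: plancherel_sigma_prod.
- by apply: measurable_phase_sum; exact: measurable_phase_Rn.
- exact: measurable_phaseR.
- by apply: plancherel_sigma_prod; exact: measurable_phase_Rn || exact: plancherel_Rn.
- exact: plancherel_lebesgue.
Qed.

End plancherel_heisenberg.

(** * Invariance of Lebesgue measure under the translations of the group *)

Section heisenberg_translations.
Context {R : realType}.

Lemma measurable_vadd n : measurable_fun setT (fun z : Rn R n * Rn R n => vadd z.1 z.2).
Proof.
apply/measurable_fun_tnthP => i.
rewrite (_ : _ \o _ = fun z : Rn R n * Rn R n => (tnth z.1 i : R) + (tnth z.2 i : R)).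
  apply: measurable_funD.
    exact: (measurableT_comp (measurable_tnth i) measurable_fst).
  exact: (measurableT_comp (measurable_tnth i) measurable_snd).
by apply/funext => z /=; rewrite tnth_mktuple.
Qed.

Lemma vaddC n (p q : Rn R n) : vadd p q = vadd q p.
Proof. by apply: eq_from_tnth => i; rewrite !tnth_mktuple addrC. Qed.

Lemma measurable_vaddr n (a : Rn R n) : measurable_fun setT (fun x : Rn R n => vadd x a).
Proof. exact: (measurableT_comp (@measurable_vadd n) (pair2_measurable a)). Qed.

Lemma vadd_tuple_cons n (z : measurableTypeR R * Rn R n) (a : Rn R n.+1) :
  vadd (tuple_cons z) a =
  tuple_cons (((z.1 : R) + thead a : measurableTypeR R), vadd z.2 [tuple of behead a]).
Proof.
apply: eq_from_tnth => i; rewrite tnth_mktuple.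
case: (unliftP ord0 i) => [j|] ->; rewrite ?tnthS ?tnth0.
  rewrite tnth_mktuple tnth_behead; congr (_ + tnth a _).
  by apply: val_inj; rewrite /= inordK// ltnS.
by [].
Qed.

Lemma ge0_integral_Rn_shift n (a : Rn R n) (f : Rn R n -> \bar R) :
  measurable_fun setT f -> (forall x, (0 <= f x)%E) ->
  (\int[lebesgueRn R n]_x f (vadd x a) = \int[lebesgueRn R n]_x f x)%E.
Proof.
elim: n a f => [|n IHn] a f mf f0.
  by apply: eq_integral => x _; congr f; rewrite [LHS]tuple0 [RHS]tuple0.
have mc := @measurable_tuple_cons R n.
have mfa : measurable_fun setT (fun x => f (vadd x a)).
  exact: (measurableT_comp mf (@measurable_vaddr n.+1 a)).
rewrite !(ge0_integral_pushforwardT mc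
  (erefl : lebesgueRn R n.+1 = _ :> (set _ -> \bar R)))//.
have mfc : measurable_fun setT (f \o @tuple_cons R n) by exact: measurableT_comp.
have mfac : measurable_fun setT (fun z => f (vadd (tuple_cons z) a)).
  exact: (measurableT_comp mfa mc).
rewrite (tonelli_sigma_prod1 _ _ mfac (fun z => f0 _)).
rewrite (tonelli_sigma_prod1 _ _ mfc (fun z => f0 _)).
transitivity (\int[lebesgue_measure]_x
    (fubini_F (lebesgueRn R n) (f \o @tuple_cons R n)) ((x : R) + thead a)%R)%E.
  apply: eq_integral => x _; rewrite /fubini_F /=.
  under eq_integral do rewrite vadd_tuple_cons.
  rewrite (IHn [tuple of behead a]
    (fun y => f (tuple_cons (((x : R) + thead a : measurableTypeR R), y))))//.
  exact: (measurableT_comp mfc (pair1_measurable _)).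
apply: ge0_integral_shift.
  exact: (measurable_fun_fubini_tonelli_F _ mfc (fun z => f0 _)).
by move=> x; apply: integral_ge0 => y _; exact: f0.
Qed.

Variable n : nat.
Local Notation H := (heis R n).

(** The common form of left and right translations by a fixed element: (p, q) is shifted by a
    constant, and t by an amount that depends only on (p, q). *)
Definition shear (a b : Rn R n) (c : Rn R n * Rn R n -> R) (X : H) : H :=
  (vadd X.1.1 a, vadd X.1.2 b, (X.2 : R) + c X.1).

(** With t integrated innermost, [c] is constant during that integration, which therefore sees only
    a shift of the line; shifts in q and p remain. *)
Lemma ge0_integral_shear (a b : Rn R n) (c : Rn R n * Rn R n -> R) (f : H -> \bar R) :
  measurable_fun setT c -> measurable_fun setT f -> (forall x, (0 <= f x)%E) ->
  (\int[haar R n]_X f (shear a b c X) = \int[haar R n]_X f X)%E.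
Proof.
move=> mc mf f0.
have ma := measurable_vaddr a; have mb := measurable_vaddr b.
pose u (z : Rn R n * Rn R n) := (vadd z.1 a, vadd z.2 b).
have mu : measurable_fun setT u.
  apply: measurable_fun_pair.
    exact: (measurableT_comp ma measurable_fst).
  exact: (measurableT_comp mb measurable_snd).
have mv : measurable_fun setT (shear a b c).
  apply: measurable_fun_pair; first exact: (measurableT_comp mu measurable_fst).
  apply: measurable_funD; first exact: measurable_snd.
  exact: (measurableT_comp mc measurable_fst).
have mfv : measurable_fun setT (fun X => f (shear a b c X)).
  exact: (measurableT_comp mf mv).
rewrite /haar /= (tonelli_sigma_prod1 _ _ mfv (fun z => f0 _)).
rewrite (tonelli_sigma_prod1 _ _ mf f0).
pose G := fubini_F (@lebesgue_measure R) f.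
have mG : measurable_fun setT G by exact: (measurable_fun_fubini_tonelli_F _ mf f0).
have G0 z : (0 <= G z)%E by apply: integral_ge0 => y _; exact: f0.
transitivity (\int[sigma_prod (lebesgueRn R n) (lebesgueRn R n)]_z G (u z))%E.
  apply: eq_integral => z _.
  apply: (@ge0_integral_shift R (c z) (fun t => f (u z, t))); last by move=> ?; exact: f0.
  exact: (measurableT_comp mf (pair1_measurable _)).
have mGu : measurable_fun setT (fun z => G (u z)) by exact: (measurableT_comp mG mu).
rewrite (tonelli_sigma_prod1 _ _ mGu (fun z => G0 _)).
rewrite [RHS](tonelli_sigma_prod1 _ _ mG G0).
transitivity (\int[lebesgueRn R n]_p (fubini_F (lebesgueRn R n) G) (vadd p a))%E.
  apply: eq_integral => p _.
  apply: (@ge0_integral_Rn_shift n b (fun q => G (vadd p a, q))); last by move=> ?; exact: G0.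
  exact: (measurableT_comp mG (pair1_measurable _)).
apply: ge0_integral_Rn_shift.
  exact: (measurable_fun_fubini_tonelli_F _ mG G0).
by move=> x; apply: integral_ge0 => y _; exact: G0.
Qed.

Lemma hmulE (X P : H) : hmul X P =
  (vadd X.1.1 P.1.1, vadd X.1.2 P.1.2,
   (X.2 : R) + (P.2 : R) + 2^-1 * (vdot X.1.1 P.1.2 - vdot X.1.2 P.1.1)).
Proof. by case: X => [[p q] t]; case: P => [[p' q'] t']. Qed.

Lemma measurable_hmul : measurable_fun setT (fun z : H * H => hmul z.1 z.2).
Proof.
under eq_fun do rewrite hmulE.
have m11 := measurableT_comp measurable_fst (measurable_fst : measurable_fun [set: H * H] fst).
have m12 := measurableT_comp measurable_fst (measurable_snd : measurable_fun [set: H * H] snd).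
have mp1 := measurableT_comp measurable_fst m11.
have mq1 := measurableT_comp measurable_snd m11.
have mp2 := measurableT_comp measurable_fst m12.
have mq2 := measurableT_comp measurable_snd m12.
apply: measurable_fun_pair.
  apply: measurable_fun_pair.
    exact: (measurableT_comp (@measurable_vadd n) (measurable_fun_pair mp1 mp2)).
  exact: (measurableT_comp (@measurable_vadd n) (measurable_fun_pair mq1 mq2)).
apply: measurable_funD.
  apply: measurable_funD.
    exact: (measurableT_comp measurable_snd measurable_fst).
  exact: (measurableT_comp measurable_snd measurable_snd).
apply: measurable_funM => //; apply: measurable_funB.
  exact: (measurableT_comp (@measurable_vdot R n) (measurable_fun_pair mp1 mq2)).
exact: (measurableT_comp (@measurable_vdot R n) (measurable_fun_pair mq1 mp2)).
Qed.

Lemma measurable_symplectic (p q : Rn R n) (t : R) :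
  measurable_fun setT (fun z : Rn R n * Rn R n => t + 2^-1 * (vdot z.1 q - vdot z.2 p)).
Proof.
have m1 : measurable_fun setT (fun z : Rn R n * Rn R n => (z.1, q)).
  exact: measurable_fun_pair.
have m2 : measurable_fun setT (fun z : Rn R n * Rn R n => (z.2, p)).
  exact: measurable_fun_pair.
apply: measurable_funD => //; apply: measurable_funM => //; apply: measurable_funB.
  exact: (measurableT_comp (@measurable_vdot R n) m1).
exact: (measurableT_comp (@measurable_vdot R n) m2).
Qed.

Lemma vdotC (p q : Rn R n) : vdot p q = vdot q p.
Proof. by apply: eq_bigr => i _; rewrite mulrC. Qed.

Lemma ge0_integral_hmulr (P : H) (f : H -> \bar R) :
  measurable_fun setT f -> (forall x, (0 <= f x)%E) ->
  (\int[haar R n]_X f (hmul X P) = \int[haar R n]_X f X)%E.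
Proof.
move=> mf f0.
rewrite -(ge0_integral_shear P.1.1 P.1.2 (measurable_symplectic P.1.1 P.1.2 P.2) mf f0).
by apply: eq_integral => X _; congr f; rewrite hmulE /shear addrA.
Qed.

Lemma ge0_integral_hmull (X : H) (f : H -> \bar R) :
  measurable_fun setT f -> (forall x, (0 <= f x)%E) ->
  (\int[haar R n]_P f (hmul X P) = \int[haar R n]_P f P)%E.
Proof.
move=> mf f0.
(* The symplectic form changes sign when the two factors are exchanged, hence the negated function,
   taken with [- X.2] to leave the shift in t positive. *)
rewrite -(ge0_integral_shear X.1.1 X.1.2
  (measurable_funN (measurable_symplectic X.1.1 X.1.2 (- X.2))) mf f0).
apply: eq_integral => P _; congr f; rewrite hmulE /shear.
rewrite (vaddC X.1.1) (vaddC X.1.2); congr (_, _) => /=.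
by rewrite (vdotC X.1.1) (vdotC X.1.2); ring.
Qed.

End heisenberg_translations.

(** * Completeness of L2 *)

Lemma cvg_geometric_increments (R : realType) (v : nat -> R) (C : R) :
  (forall j, `|v j.+1 - v j| <= C * 2^-1 ^+ j) -> cvgn v.
Proof.
move=> vC.
have Cg : cvgn (series (geometric C (2^-1 : R))).
  by apply: is_cvg_geometric_series; rewrite ger0_norm// invf_lt1// ltr1n.
have : cvgn [normed series (telescope v)].
  apply: (series_le_cvg _ _ _ Cg) => j /=; first exact: normr_ge0.
    by apply: le_trans (vC j); exact: normr_ge0.
  exact: vC.
move=> /normed_cvg; rewrite telescopeK => Cv.
rewrite (_ : v = [sequence v n - v 0%N]_n + cst (v 0%N)).
  by apply: is_cvgD => //; exact: is_cvg_cst.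
by apply/funext => n; rewrite /= fctE subrK.
Qed.

Section riesz_fischer.
Context d (T : measurableType d) (R : realType).
Variable mu : {measure set T -> \bar R}.
Implicit Types f : nat -> T -> R[i].

Definition cauchy2 f : Prop := forall e : R, 0 < e ->
  exists N, forall j k, (N <= j)%N -> (N <= k)%N ->
    norm2 mu (fun x => f j x - f k x) < e.

Lemma fast_subsequence f (eps : nat -> R) : (forall j, 0 < eps j) -> cauchy2 f ->
  exists2 m : nat -> nat, (forall j, (m j <= m j.+1)%N) &
    forall j i k, (m j <= i)%N -> (m j <= k)%N ->
      norm2 mu (fun x => f i x - f k x) < eps j.
Proof.
move=> eps0 Cf.
have /choice [N HN] : forall j, exists N, forall i k, (N <= i)%N -> (N <= k)%N ->
    norm2 mu (fun x => f i x - f k x) < eps j by move=> j; exact: Cf.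
(* Partial sums are nondecreasing and dominate each [N j]. *)
exists (fun j => \sum_(i < j.+1) N i)%N => [j|j i k mi mk].
  by rewrite [leqRHS]big_ord_recr leq_addr.
have Nm : (N j <= \sum_(i < j.+1) N i)%N by rewrite big_ord_recr leq_addl.
by apply: HN; [exact: leq_trans mi|exact: leq_trans mk].
Qed.

Lemma limn_einf_le (u : nat -> \bar R) (c : \bar R) (N : nat) :
  (forall n, (N <= n)%N -> (u n <= c)%E) -> (limn_einf u <= c)%E.
Proof.
move=> uc; rewrite limn_einf_lim; apply: lime_le; first exact: is_cvg_einfs.
apply: nearW => n; apply: (@le_trans _ _ (u (maxn n N))); last exact/uc/leq_maxr.
by apply: ereal_inf_lbound; exists (maxn n N) => //=; exact: leq_maxl.
Qed.

(** Along a fast subsequence the weighted sum [S] of squared increments is integrable; where it is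
    finite, the increments are at most sqrt (S x) / 2^j and the values converge. Fatou's lemma along
    the subsequence, with the other index fixed, then controls the whole sequence. *)
Lemma riesz_fischer f : (forall k, L2 mu (f k)) -> cauchy2 f ->
  exists2 h, L2 mu h & forall e : R, 0 < e ->
    exists N, forall k, (N <= k)%N -> norm2 mu (fun x => f k x - h x) < e.
Proof.
move=> Lf Cf.
(* The factor 4^-j absorbs the weight 4^j of [D], and the remaining 2^-(j+1) sum to 1. *)
pose eps j : R := (4 ^+ j)^-1 * (2 ^ (j + 1))%:R^-1.
have eps0 j : 0 < eps j by rewrite mulr_gt0 ?invr_gt0 ?exprn_gt0// ltr0n expn_gt0.
have [m mS mE] := fast_subsequence eps0 Cf.
pose g j := f (m j).
have Lg j : L2 mu (g j) by exact: Lf.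
pose D j x := (4 ^+ j * nsq (g j.+1 x - g j x))%:E.
have mD j : measurable_fun setT (D j).
  apply/measurable_EFinP; apply: measurable_funM => //.
  by apply: measurable_nsq; case: (L2B (Lg j.+1) (Lg j)).
have D0 j x : (0 <= D j x)%E by rewrite lee_fin mulr_ge0 ?exprn_ge0 ?nsq_ge0.
pose S x := (\sum_(j <oo) D j x)%E.
have S0 x : (0 <= S x)%E by apply: nneseries_ge0 => j _ _; exact: D0.
have mS_ : measurable_fun setT S.
  by apply: ge0_emeasurable_sum => // j x _; exact: D0.
have Soo : (\int[mu]_x S x < +oo)%E.
  rewrite integral_nneseries//.
  apply: (@le_lt_trans _ _ 1%E); last by rewrite ltry.
  have <- : limn (eseries (fun k => (1 / (2 ^ (k + 1))%:R)%:E)) = (1 : R)%:E.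
    apply/cvg_lim => //; rewrite [X in _ --> X](_ : _ = (1 / 2 ^+ 0)%:E); last first.
      by rewrite expr0 divr1.
    exact: cvg_geometric_eseries_half.
  apply: lee_nneseries => j _ ; first by move=> _; apply: integral_ge0.
  rewrite /D; under eq_integral do rewrite EFinM.
  have mdj : measurable_fun setT (fun x => (nsq (g j.+1 x - g j x))%:E).
    by apply: measurable_EFin_nsq; case: (L2B (Lg j.+1) (Lg j)).
  rewrite (ge0_integralZl mu measurableT mdj)//; last by move=> x _; rewrite lee_fin nsq_ge0.
  rewrite -/(enorm2 mu (fun x => g j.+1 x - g j x)) enorm2E; last exact: L2B.
  rewrite -EFinM lee_fin -ler_pdivlMl ?exprn_gt0// div1r.
  exact/ltW/(mE j _ _ (mS j) (leqnn _)).
pose A := [set x | (S x < +oo)%E].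
have mA : measurable A.
  by rewrite -[A]setTI; apply: emeasurable_fun_infty_o.
have Aae : {ae mu, forall x, A x}.
  have /(integrable_ae measurableT) : mu.-integrable setT S.
    by apply/integrableP; split => //; under eq_integral do rewrite gee0_abs//.
  by apply: filterS => x /(_ I); rewrite ge0_fin_numE.
(* Setting the functions to 0 off [A] makes them converge at every point, so that the limit is
   measurable. *)
pose u j x : R[i] := (\1_A x)%:C * g j x.
have mu_ j : cmeasurable (u j).
  apply: cmeasurableM; last by case: (Lg j).
  by split => //=; exact: measurable_indic.
have uB j x : nsq (u j.+1 x - u j x) <= fine (S x) * (2^-1 ^+ j) ^+ 2.
  rewrite /u -mulrBr nsqM nsq_real indicE.
  have [xA|xA] := boolP (x \in A); last first.
    by rewrite expr0n mul0r mulr_ge0 ?fine_ge0 ?sqr_ge0.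
  rewrite expr1n mul1r -exprM mulnC exprM expr2 -invfM -natrM.
  rewrite exprVn ler_pdivlMr ?exprn_gt0// mulrC -lee_fin fineK; last first.
    by rewrite ge0_fin_numE//; move: xA; rewrite inE.
  have := @nneseries_lim_ge R (D ^~ x) xpredT 0%N j.+1 (fun i _ _ => D0 i x).
  rewrite big_mkord big_ord_recr/=; apply: le_trans.
  by rewrite leeDr// sume_ge0.
have cRe x : cvgn (fun j => Re (u j x)).
  apply: (@cvg_geometric_increments _ _ (Num.sqrt (fine (S x)))) => j.
  rewrite -cReN -cReD; apply: (le_trans (normr_Re_le _)).
  rewrite cabsE -[X in _ * X]ger0_norm ?exprn_ge0// -sqrtr_sqr -sqrtrM ?fine_ge0//.
  by rewrite ler_wsqrtr.
have cIm x : cvgn (fun j => Im (u j x)).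
  apply: (@cvg_geometric_increments _ _ (Num.sqrt (fine (S x)))) => j.
  rewrite -cImN -cImD; apply: (le_trans (normr_Im_le _)).
  rewrite cabsE -[X in _ * X]ger0_norm ?exprn_ge0// -sqrtr_sqr -sqrtrM ?fine_ge0//.
  by rewrite ler_wsqrtr.
pose h x : R[i] := (limn (fun j => Re (u j x))) +i* (limn (fun j => Im (u j x))).
have mh : cmeasurable h.
  split => /=.
    by apply: (@measurable_fun_cvg _ _ _ setT (fun j x => Re (u j x))) => [j|x _];
      [case: (mu_ j)|exact: cRe].
  by apply: (@measurable_fun_cvg _ _ _ setT (fun j x => Im (u j x))) => [j|x _];
    [case: (mu_ j)|exact: cIm].
have key k j : (m j <= k)%N -> (enorm2 mu (fun x => (f k x - h x)%R) <= (eps j)%:E)%E.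
  move=> jk; have mfk : cmeasurable (f k) by case: (Lf k).
  pose F i x := (nsq (f k x - u i x))%:E.
  have mF i : measurable_fun setT (F i).
    by apply: measurable_EFin_nsq; apply: cmeasurableD => //; exact: cmeasurableN.
  have F0 i x : (0 <= F i x)%E by rewrite lee_fin nsq_ge0.
  have FE x : limn_einf (F ^~ x) = (nsq (f k x - h x))%:E.
    suff : F ^~ x @ \oo --> (nsq (f k x - h x))%:E by move=> /cvg_limn_einf_sup[].
    apply: cvg_EFin; first exact: nearW.
    have sq (a : R) (b : nat -> R) (l : R) :
        b @ \oo --> l -> (a - b n) ^+ 2 @[n --> \oo] --> (a - l) ^+ 2.
      move=> bl; have c : a - b n @[n --> \oo] --> a - l.
        by apply: cvgB => //; exact: cvg_cst.
      by under eq_fun do rewrite expr2; rewrite expr2; exact: cvgM.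
    rewrite /F /nsq; under eq_fun do rewrite /= cReD cImD cReN cImN.
    rewrite cReD cImD cReN cImN.
    by apply: cvgD; apply: sq; [exact: (cRe x)|exact: (cIm x)].
  rewrite /enorm2; under eq_integral do rewrite -FE.
  apply: (le_trans (fatou mu measurableT mF (fun n x _ => F0 n x))).
  have mleq i l : (i <= l)%N -> (m i <= m l)%N.
    by move=> il; rewrite -(subnK il); elim: (l - i)%N => // q IHq; exact: leq_trans (mS _).
  apply: (@limn_einf_le _ _ j) => i ji.
  have -> : (\int[mu]_x F i x = enorm2 mu (fun x => (f k x - g i x)%R))%E.
    apply: ge0_ae_eq_integral => //.
    - by apply: measurable_EFin_nsq; case: (L2B (Lf k) (Lg i)).
    - by move=> x _; rewrite lee_fin nsq_ge0.
    - by apply: filterS Aae => x Ax _; rewrite /F /u indicE mem_set// mul1r.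
  rewrite (enorm2E (L2B (Lf k) (Lg i))) lee_fin.
  exact/ltW/(mE j _ _ jk (mleq _ _ ji)).
have Lh : L2 mu h.
  have Lfh : L2 mu (fun x => f (m 0%N) x - h x).
    split; last by apply: le_lt_trans (key _ _ (leqnn _)) _; rewrite ltry.
    by apply: cmeasurableD; [case: (Lf (m 0%N))|exact: cmeasurableN].
  have := L2B (Lf (m 0%N)) Lfh.
  by under eq_fun do rewrite opprB addrC subrK.
exists h => // e e0.
have [j je] : exists j : nat, j.+1%:R^-1 < e.
  have [j _ /(_ j (leqnn j))] := near_infty_natSinv_lt (PosNum e0).
  by exists j.
exists (m j) => k jk; rewrite -lte_fin -(enorm2E (L2B (Lf k) Lh)).
apply: (le_lt_trans (key k j jk)); rewrite lte_fin; apply: le_lt_trans je.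
rewrite /eps; apply: (@le_trans _ _ (1 * (2 ^ (j + 1))%:R^-1)).
  rewrite ler_wpM2r ?invr_ge0// invf_le1 ?exprn_gt0// exprn_ege1//.
  by rewrite ler1n.
by rewrite mul1r lef_pV2 ?posrE ?ltr0n ?expn_gt0// ler_nat addn1 ltnW// ltn_expl.
Qed.

End riesz_fischer.

(** * The short-time Fourier transform *)

Section fourier_representation.
Context {R : realType} {n : nat}.
Local Notation H := (heis R n).
Local Notation mu := (haar R n).
Implicit Types f g h : H -> R[i].

(* If there were no unitary extension, [fourier] would be [idfun], which has these
   three properties as well; so they need no existence theorem. *)
Lemma fourier_unitary :
  [/\ forall f, L2 mu f -> L2 mu (fourier f),
      forall f h, L2 mu f -> L2 mu h ->
        L2dot mu (fourier f) (fourier h) = L2dot mu f h &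
      forall h, L2 mu h ->
        exists2 f, L2 mu f & {ae mu, forall X, fourier f X = h X}].
Proof.
rewrite /fourier; case: xgetP => [U _ [UL _ Ud Us _]|_].
  split=> [f /cLp2P/UL/cLp2P//|f h /cLp2P Lf /cLp2P Lh|h /cLp2P/Us[f /cLp2P Lf fh]].
    exact: Ud.
  by exists f.
split => // h Lh; exists h => //.
exact: aeW.
Qed.

Lemma L2_fourier f : L2 mu f -> L2 mu (fourier f).
Proof. by have [+ _ _] := fourier_unitary; apply. Qed.

Lemma L2dot_fourier f h : L2 mu f -> L2 mu h ->
  L2dot mu (fourier f) (fourier h) = L2dot mu f h.
Proof. by have [_ + _] := fourier_unitary; apply. Qed.

Lemma norm2_fourier f : L2 mu f -> norm2 mu (fourier f) = norm2 mu f.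
Proof. by move=> Lf; rewrite -!Re_L2dotff L2dot_fourier. Qed.

(** Surjectivity makes the set from which [xget] chooses nonempty. *)
Lemma inv_fourierP h : L2 mu h ->
  L2 mu (inv_fourier h) /\ {ae mu, forall X, fourier (inv_fourier h) X = h X}.
Proof.
move=> Lh; have [_ _ /(_ h Lh) [f Lf fh]] := fourier_unitary.
rewrite /inv_fourier; case: xgetP => [u _ [/cLp2P Lu uh]//|/(_ f)[]].
by split => //; exact/cLp2P.
Qed.

Lemma L2_translation P g : L2 mu g -> L2 mu (translation P g).
Proof.
move=> [mg goo]; have mP := measurableT_comp (@measurable_hmul R n) (pair2_measurable P).
split; first exact: (cmeasurable_comp mg mP).
rewrite /enorm2 (ge0_integral_hmulr P (measurable_EFin_nsq mg))//.
by move=> X; rewrite lee_fin nsq_ge0.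
Qed.

Lemma norm2_translation P g : L2 mu g -> norm2 mu (translation P g) = norm2 mu g.
Proof.
move=> [mg _]; rewrite /norm2 /Rintegral.
rewrite (ge0_integral_hmulr P (measurable_EFin_nsq mg))//.
by move=> X; rewrite lee_fin nsq_ge0.
Qed.

Lemma L2_modulation Q g : L2 mu g -> L2 mu (modulation Q g).
Proof.
move=> Lg; apply: (@L2_bounded _ _ _ _ _ _ 1) => //.
  apply: cmeasurable_cexpi.
  exact: (measurable_phase (@measurable_phaseH R n) Q).
by move=> X; rewrite nsq_cexpi.
Qed.

Lemma norm2_modulation Q g : norm2 mu (modulation Q g) = norm2 mu g.
Proof. by apply: eq_Rintegral => X _; rewrite nsqM nsq_cexpi mul1r. Qed.

Lemma L2_pi_pr Q P g : L2 mu g -> L2 mu (pi_pr Q P g).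
Proof.
move=> Lg; have /L2_fourier/(L2_translation P)/(L2_modulation Q) := Lg.
by move=> /inv_fourierP[].
Qed.

Lemma fourier_pi_pr Q P g : L2 mu g ->
  {ae mu, forall X, fourier (pi_pr Q P g) X =
                    modulation Q (translation P (fourier g)) X}.
Proof.
move=> Lg; have /L2_fourier/(L2_translation P)/(L2_modulation Q) := Lg.
by move=> /inv_fourierP[].
Qed.

Lemma norm2_pi_pr Q P g : L2 mu g -> norm2 mu (pi_pr Q P g) = norm2 mu g.
Proof.
move=> Lg; have Lw := L2_pi_pr Q P Lg.
have LMT := L2_modulation Q (L2_translation P (L2_fourier Lg)).
have ae1 := fourier_pi_pr Q P Lg.
rewrite -(norm2_fourier Lw) -Re_L2dotff.
rewrite (ae_eq_L2dotl (L2_fourier Lw) LMT (L2_fourier Lw) ae1).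
rewrite (ae_eq_L2dotr LMT (L2_fourier Lw) LMT ae1) Re_L2dotff.
by rewrite norm2_modulation norm2_translation ?norm2_fourier//; exact: L2_fourier.
Qed.

Definition stft_integrand g f (z : H * H) : R[i] :=
  fourier f z.1 * (fourier g (hmul z.1 z.2))^*.

(** The inner product is moved to the Fourier side, where [pi_pr] is explicit almost everywhere. An
    inner product ignores null sets, so the formula holds at every (Q, P). *)
Lemma stftE g f Q P : L2 mu g -> L2 mu f ->
  stft g f (Q, P) = ft mu (@phaseH R n) (fun X => stft_integrand g f (X, P)) Q.
Proof.
move=> Lg Lf; have Lw := L2_pi_pr Q P Lg.
have LMT := L2_modulation Q (L2_translation P (L2_fourier Lg)).
rewrite /stft -(L2dot_fourier Lf Lw).
rewrite (ae_eq_L2dotr (L2_fourier Lf) (L2_fourier Lw) LMT (fourier_pi_pr Q P Lg)).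
apply: eq_cint => X.
by rewrite /modulation /translation rmorphM /= conj_cexpi /stft_integrand mulrA mulrAC.
Qed.

Lemma cmeasurable_stft_integrand g f : L2 mu g -> L2 mu f ->
  cmeasurable (stft_integrand g f).
Proof.
move=> /L2_fourier[mG _] /L2_fourier[mF _]; apply: cmeasurableM.
  exact: (cmeasurable_comp mF measurable_fst).
exact/cmeasurable_conj/(cmeasurable_comp mG (@measurable_hmul R n)).
Qed.

Lemma cmeasurable_stft g f : L2 mu g -> L2 mu f -> cmeasurable (stft g f).
Proof.
move=> Lg Lf; have mK := cmeasurable_stft_integrand Lg Lf.
pose k (w : (H * H) * H) := stft_integrand g f (w.2, w.1.2) * cexpi (- phaseH w.1.1 w.2).
have -> : stft g f = fun z => cint mu (fun X => k (z, X)).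
  by apply/funext => -[Q P]; rewrite stftE.
have m11 : measurable_fun setT (fun w : (H * H) * H => w.1.1).
  exact: (measurableT_comp measurable_fst measurable_fst).
have m12 : measurable_fun setT (fun w : (H * H) * H => w.1.2).
  exact: (measurableT_comp measurable_snd measurable_fst).
have m2 : measurable_fun setT (fun w : (H * H) * H => w.2) by exact: measurable_snd.
apply: (@cmeasurable_cint _ _ _ _ _ mu k); apply: cmeasurableM.
  exact: (cmeasurable_comp mK (measurable_fun_pair m2 m12)).
apply: cmeasurable_cexpi; apply: measurable_funN.
exact: (measurableT_comp (@measurable_phaseH R n) (measurable_fun_pair m11 m2)).
Qed.

(** Integrating over P first, left invariance removes X from the second factor and the two norms
    separate. *)
Lemma enorm2_stft_integrand g f : L2 mu g -> L2 mu f ->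
  enorm2 (haar2 R n) (stft_integrand g f) = (norm2 mu f * norm2 mu g)%:E.
Proof.
move=> Lg Lf; have mK := cmeasurable_stft_integrand Lg Lf.
have LF := L2_fourier Lf; have LG := L2_fourier Lg.
rewrite /haar2 (enorm2_sigma_prod1 _ _ mK).
transitivity (\int[mu]_X ((norm2 mu g)%:E * (nsq (fourier f X))%:E))%E.
  apply: eq_integral => X _; rewrite -(norm2_fourier Lg) -(enorm2E LG) muleC.
  rewrite /enorm2 /stft_integrand /=.
  under eq_integral do rewrite nsqM nsqC EFinM.
  have mG : measurable_fun setT (fun P => (nsq (fourier g P))%:E).
    by apply: measurable_EFin_nsq; case: LG.
  have mGX : measurable_fun setT (fun P => (nsq (fourier g (hmul X P)))%:E).
    apply: (measurableT_comp mG).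
    exact: (measurableT_comp (@measurable_hmul R n) (pair1_measurable X)).
  have G0 P : (0 <= (nsq (fourier g P))%:E)%E by rewrite lee_fin nsq_ge0.
  rewrite (ge0_integralZl mu measurableT mGX (fun P _ => G0 _)) ?lee_fin ?nsq_ge0//.
  by rewrite (ge0_integral_hmull X mG G0).
have mF : measurable_fun setT (fun X => (nsq (fourier f X))%:E).
  by apply: measurable_EFin_nsq; case: LF.
have F0 X : (0 <= (nsq (fourier f X))%:E)%E by rewrite lee_fin nsq_ge0.
rewrite (ge0_integralZl mu measurableT mF (fun X _ => F0 _)) ?lee_fin ?norm2_ge0//.
by rewrite -/(enorm2 mu (fourier f)) (enorm2E LF) norm2_fourier// mulrC EFinM.
Qed.

(** Plancherel's identity in Q is applied at almost every P: right invariance makes the translated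
    window square integrable, hence the slice integrable; its square integrability comes from
    [enorm2_stft_integrand]. *)
Lemma enorm2_stft g f : L2 mu g -> L2 mu f ->
  enorm2 (haar2 R n) (stft g f) = (norm2 mu f * norm2 mu g)%:E.
Proof.
move=> Lg Lf; have mK := cmeasurable_stft_integrand Lg Lf.
have mV := cmeasurable_stft Lg Lf.
have EK := enorm2_stft_integrand Lg Lf.
have LK : L2 (haar2 R n) (stft_integrand g f) by split => //; rewrite EK ltry.
rewrite -EK /haar2 (enorm2_sigma_prod2 _ _ mV) (enorm2_sigma_prod2 _ _ mK).
apply: ge0_ae_eq_integral => //.
- exact: (measurable_enorm2_2 _ mV).
- exact: (measurable_enorm2_2 _ mK).
- by move=> P _; exact: enorm2_ge0.
- by move=> P _; exact: enorm2_ge0.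
- have ae1 := ae_L2_2 LK; apply: filterS ae1 => P LKP _.
  under eq_fun do rewrite (stftE _ _ Lg Lf).
  apply: (plancherel_haar _ LKP).
  exact: (cintegrable_mul_conj (L2_fourier Lf) (L2_translation P (L2_fourier Lg))).
Qed.

Lemma L2_stft g f : L2 mu g -> L2 mu f -> L2 (haar2 R n) (stft g f).
Proof.
by move=> Lg Lf; split; [exact: cmeasurable_stft|rewrite enorm2_stft// ltry].
Qed.

Lemma norm2_stft g f : L2 mu g -> L2 mu f ->
  norm2 (haar2 R n) (stft g f) = norm2 mu f * norm2 mu g.
Proof. by move=> Lg Lf; rewrite /norm2 /Rintegral -/(enorm2 _ _) enorm2_stft. Qed.

Lemma stft_lin g (a : R[i]) f h : L2 mu g -> L2 mu f -> L2 mu h ->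
  stft g (fun X => a * f X + h X) = (fun z => a * stft g f z + stft g h z).
Proof.
by move=> Lg Lf Lh; apply/funext => z; rewrite /stft L2dotlin//; exact: L2_pi_pr.
Qed.

Lemma stftD g f h : L2 mu g -> L2 mu f -> L2 mu h ->
  stft g (fun X => f X + h X) = (fun z => stft g f z + stft g h z).
Proof.
by move=> Lg Lf Lh; apply/funext => z; rewrite /stft L2dotDl//; exact: L2_pi_pr.
Qed.

Lemma stftZ g (a : R[i]) f : L2 mu g -> L2 mu f ->
  stft g (fun X => a * f X) = (fun z => a * stft g f z).
Proof.
by move=> Lg Lf; apply/funext => z; rewrite /stft L2dotZl//; exact: L2_pi_pr.
Qed.

Lemma stftB g f h : L2 mu g -> L2 mu f -> L2 mu h ->
  stft g (fun X => f X - h X) = (fun z => stft g f z - stft g h z).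
Proof.
move=> Lg Lf Lh; rewrite subZE stftD//; last exact: L2Z.
by rewrite stftZ// subZE.
Qed.

(** The orthogonality relation of Moyal for a fixed window. By linearity [f + h] and [f + i h] have
    the corresponding transforms, so polarization reduces it to norms. *)
Lemma L2dot_stft g f h : L2 mu g -> L2 mu f -> L2 mu h ->
  L2dot (haar2 R n) (stft g f) (stft g h) = (norm2 mu g)%:C * L2dot mu f h.
Proof.
move=> Lg Lf Lh; have Lih := L2Z 'i%C Lh.
rewrite (L2dot_polarization (L2_stft Lg Lf) (L2_stft Lg Lh)).
have -> : (fun z => stft g f z + 'i%C * stft g h z) =
    stft g (fun X => f X + 'i%C * h X) by rewrite stftD// stftZ.
rewrite -(stftD Lg Lf Lh) !norm2_stft//; [|exact: L2D..].
rewrite (L2dot_polarization Lf Lh); apply: complexP; rewrite !reimE /=; by field.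
Qed.

End fourier_representation.

(** * The range as a reproducing kernel Hilbert space *)

Section stft_range_hilbert.
Context {R : realType} {n : nat}.
Local Notation H := (heis R n).
Local Notation mu := (haar R n).
Local Notation mu2 := (haar2 R n).
Variable g : H -> R[i].
Hypothesis Lg : L2 mu g.
Hypothesis g_neq0 : ~ {ae mu, forall X, g X = 0}.

Lemma norm2_window_gt0 : 0 < norm2 mu g.
Proof.
rewrite lt_neqAle norm2_ge0 andbT eq_sym; apply/eqP => g0.
exact/g_neq0/norm2_eq0.
Qed.

Lemma stft_rangeP F : stft_range g F -> exists2 f, L2 mu f & F = stft g f.
Proof. by move=> [f /cLp2P Lf <-]; exists f. Qed.

Lemma stft_range_stft f : L2 mu f -> stft_range g (stft g f).
Proof. by move=> /cLp2P Lf; exists f. Qed.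

Lemma L2_stft_range F : stft_range g F -> L2 mu2 F.
Proof. by move=> /stft_rangeP[f Lf ->]; exact: L2_stft. Qed.

Lemma ipnormE (F : H * H -> R[i]) : ipnorm (L2dot mu2) F = Num.sqrt (norm2 mu2 F).
Proof. by rewrite /ipnorm Re_L2dotff. Qed.

(** Elements of the range are functions compared pointwise, so a null [f] must give a transform that
    is 0 at every point; Cauchy-Schwarz provides this. *)
Lemma stft_ae0 f z : L2 mu f -> {ae mu, forall X, f X = 0} -> stft g f z = 0.
Proof.
move=> Lf f0; have Lw := L2_pi_pr z.1 z.2 Lg.
have := L2dot_cauchy_schwarz Lf Lw.
rewrite (ae_eq0_norm2 Lf f0) mul0r => ns0; apply: nsq_eq0.
by apply/eqP; rewrite eq_le ns0 nsq_ge0.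
Qed.

(** The right side is also the squared norm of [stft g f], so evaluations are bounded with constant
    1; for [f = pi_pr Q P g] it becomes the square of [norm2 mu g], which bounds the kernel. *)
Lemma nsq_stft_le f z : L2 mu f -> nsq (stft g f z) <= norm2 mu f * norm2 mu g.
Proof.
move=> Lf; have := L2dot_cauchy_schwarz Lf (L2_pi_pr z.1 z.2 Lg).
by rewrite norm2_pi_pr.
Qed.

(** The map [stft g] multiplies distances by the positive norm of [g], so Cauchy sequences and
    limits pass between the range and L^2. *)
Lemma stft_range_complete (u : nat -> H * H -> R[i]) :
  (forall k, stft_range g (u k)) ->
  (forall e : R, 0 < e -> exists N, forall j k, (N <= j)%N -> (N <= k)%N ->
    ipnorm (L2dot mu2) (fun x => u j x - u k x) < e) ->
  exists2 F, stft_range g F & forall e : R, 0 < e -> exists N, forall k, (N <= k)%N ->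
    ipnorm (L2dot mu2) (fun x => u k x - F x) < e.
Proof.
move=> Su Cu; have c0 := norm2_window_gt0.
have /choice [f fu] : forall k, exists f, L2 mu f /\ u k = stft g f.
  by move=> k; have [f Lf uf] := stft_rangeP (Su k); exists f.
have Lf k : L2 mu (f k) by case: (fu k).
have E h k : L2 mu h -> ipnorm (L2dot mu2) (fun x => u k x - stft g h x) =
    Num.sqrt (norm2 mu (fun X => f k X - h X) * norm2 mu g).
  move=> Lh; have [_ ->] := fu k.
  by rewrite -stftB// ipnormE norm2_stft//; exact: L2B.
have Cf : cauchy2 mu f.
  (* [cauchy2] measures squared distances and [ipnorm] does not, hence the root; the factor
     [norm2 mu g] is the scaling of [stft g]. *)
  move=> e e0; have [|N HN] := Cu (Num.sqrt (e * norm2 mu g)).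
    by rewrite sqrtr_gt0 mulr_gt0.
  exists N => j k Nj Nk; have := HN j k Nj Nk; rewrite {1}(proj2 (fu k)) E//.
  by rewrite ltr_sqrt ?mulr_gt0// ltr_pM2r.
have [h Lh hf] := riesz_fischer Lf Cf.
exists (stft g h) => [|e e0]; first exact: stft_range_stft.
have [|N HN] := hf (e ^+ 2 / norm2 mu g); first by rewrite divr_gt0 ?exprn_gt0.
exists N => k Nk; rewrite E// -[ltRHS]ger0_norm ?(ltW e0)// -sqrtr_sqr.
by rewrite ltr_sqrt ?exprn_gt0// -ltr_pdivlMr// HN.
Qed.

Lemma stft_range_hilbert : hilbert_function_space (stft_range g) (L2dot mu2).
Proof.
have c0 := norm2_window_gt0; split.
- rewrite (_ : (fun=> 0) = stft g (fun=> 0)); first exact/stft_range_stft/L2_0.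
  by apply/funext => z; rewrite stft_ae0//; [exact: L2_0|exact: aeW].
- move=> a F G /stft_rangeP[f Lf ->] /stft_rangeP[h Lh ->].
  rewrite -(stft_lin a Lg Lf Lh); apply: stft_range_stft.
  by apply: L2D => //; exact: L2Z.
- by move=> a F G K /L2_stft_range LF /L2_stft_range LG /L2_stft_range; exact: L2dotlin.
- by move=> F G /L2_stft_range LF /L2_stft_range LG; exact: L2dotC.
- by move=> F _; rewrite L2dotff lecR norm2_ge0.
- move=> F /stft_rangeP[f Lf ->] /(congr1 (@complex.Re R)).
  rewrite Re_L2dotff norm2_stft// => /eqP; rewrite mulf_eq0 (gt_eqF c0) orbF => /eqP f0 z.
  by apply: stft_ae0 => //; exact: norm2_eq0.
- exact: stft_range_complete.
Qed.

Lemma stft_range_bounded : bounded_evaluations (stft_range g) (L2dot mu2).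
Proof.
move=> z; exists 1 => F /stft_rangeP[f Lf ->].
rewrite mul1r ipnormE norm2_stft// cabsE ler_wsqrtr//.
exact: nsq_stft_le.
Qed.

Lemma stft_kernelE z : stft_kernel g ^~ z =
  stft g (fun X => ((norm2 mu g)^-1)%:C * pi_pr z.1 z.2 g X).
Proof.
by apply/funext => z'; rewrite /stft_kernel sqr_L2norm stftZ//; exact: L2_pi_pr.
Qed.

(** By [stft_kernelE] the kernel is itself a transform, so [L2dot_stft] applies: its factor
    [norm2 mu g] cancels the normalization and leaves the inner product that defines
    [stft g f z]. *)
Lemma stft_kernel_reproducing :
  is_reproducing_kernel (stft_range g) (L2dot mu2) (stft_kernel g).
Proof.
move=> z; have c0 := norm2_window_gt0; rewrite stft_kernelE.
have Lw := L2_pi_pr z.1 z.2 Lg; have Lcw := L2Z ((norm2 mu g)^-1)%:C Lw.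
split=> [|F /stft_rangeP[f Lf ->]]; first exact: stft_range_stft.
rewrite L2dot_stft// (L2dotC Lcw Lf) L2dotZl// (L2dotC Lf Lw).
rewrite -[LHS]/(L2dot mu f (pi_pr z.1 z.2 g)); move: (L2dot mu f _) => v.
by apply: complexP; rewrite !reimE /=; field; rewrite gt_eqF.
Qed.

Lemma stft_kernel_le1 z' z : `|stft_kernel g z' z| <= 1.
Proof.
have c0 := norm2_window_gt0.
(* The norm and the order are those of [R[i]]; the bound is brought back to the reals. *)
have -> : `|stft_kernel g z' z| = (cabs (stft_kernel g z' z))%:C by [].
rewrite (_ : 1 = (1 : R)%:C)// lecR cabsE -sqrtr1 ler_wsqrtr//.
rewrite /stft_kernel sqr_L2norm nsqM nsq_real exprVn ler_pdivrMl ?exprn_gt0// mulr1 expr2.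
by apply: (le_trans (nsq_stft_le z' (L2_pi_pr z.1 z.2 Lg))); rewrite norm2_pi_pr.
Qed.

End stft_range_hilbert.

Theorem lemma2p4 (R : realType) (n : nat) (g : heis R n -> R[i]) :
  (1 <= n)%N ->
  cLp (haar R n) 2%:E g ->
  ~ {ae haar R n, forall X, g X = 0} ->
  [/\ (forall F, stft_range g F -> cLp (haar2 R n) 2%:E F),
      is_rkhs (stft_range g) (L2dot (haar2 R n)),
      is_reproducing_kernel (stft_range g) (L2dot (haar2 R n))
        (stft_kernel g),
      (forall Q' P' Q P : heis R n,
        stft_kernel g (Q', P') (Q, P) =
          ((L2norm (haar R n) g ^+ 2)^-1)%:C *
          stft g (inv_fourier (modulation Q (translation P (fourier g))))
            (Q', P')) &
      (forall Q' P' Q P : heis R n,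
        `|stft_kernel g (Q', P') (Q, P)| <= 1)].
Proof.
move=> _ /cLp2P Lg g_neq0; split.
- by move=> F /(L2_stft_range Lg)/cLp2P.
- by split; [exact: stft_range_hilbert|exact: stft_range_bounded].
- exact: stft_kernel_reproducing.
- by [].
- by move=> Q' P' Q P; exact: stft_kernel_le1.
Qed.
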